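(* Let $\Phi=\{\phi_e\}_{e\in\mathbb N}$ be a finitely irreducible CGDMS with Bowen parameter $h$, and let $F=\{f_e\}_{e\in\mathbb N}$ be a Hölder family of functions comparable to $\log\Phi'$. Fix any $0\le t\le h$ and any strictly decreasing sequence $\{q_n\}_{n\in\mathbb N}$ with $q_n\to-\infty$ as $n\to\infty$. Then there is a weak* accumulation point $\mu_\infty$ of the sequence of Gibbs states $\{\tilde\mu_{t,q_n}\}_{n\in\mathbb N}$, and this measure is $\tilde f$-minimizing, i.e. $$\int_{E_A^\infty}\tilde f\,d\mu_\infty=\xi_{\min},\qquad \xi_{\min}:=\inf_{\nu}\int_{E_A^\infty}\tilde f\,d\nu,$$ the infimum being over all $\sigma$-invariant Borel probability measures $\nu$ on $E_A^\infty$.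
   Context: CGDMS. Let $(V,E,i,t)$ be a directed multigraph with finite vertex set $V$, countable edge set $E$ (the alphabet; here $E=\mathbb N$) and maps $i,t:E\to V$, and let $A:E\times E\to\{0,1\}$ be a matrix with at least one $1$ in each row such that $A_{ab}=1$ implies $t(a)=i(b)$. Let $\{X_v\}_{v\in V}$ be nonempty compact subsets of $\mathbb R^d$ (regarded as disjoint copies), each the closure of its interior, and $X=\bigsqcup_v X_v$. A conformal graph directed Markov system (CGDMS) is a family of maps $\Phi=\{\phi_e:X_{t(e)}\to X_{i(e)}\}_{e\in E}$ (together with the graph and $A$) such that: (1) $\phi_a(\mathrm{Int}X_{t(a)})\cap\phi_b(\mathrm{Int}X_{t(b)})=\emptyset$ for $a\ne b$; (2) for every $v$ there is an open, connected, bounded $W_v\supseteq X_v$ in $\mathbb R^d$ such that each $\phi_e$ with $t(e)=v$ extends to a contracting conformal diffeomorphism of $W_v$ into $\mathbb R^d$, all with a common contraction ratio $s<1$; (3) there are $L\ge1$, $\kappa>0$ with $\bigl||\phi_e'(y)|-|\phi_e'(x)|\bigr|\le L|\phi_e'(x)|\,\|y-x\|^\kappa$ for all $e$ and $x,y\in W_{t(e)}$, where $|\phi_e'(x)|$ is the scaling factor (norm) of the derivative. Symbolic space. $E_A^n$ is the set of words $w=w_1\dots w_n$ with $A_{w_kw_{k+1}}=1$ for all $1\le k\le n-1$; $E_A^*$ is the set of all finite such words including the empty word; $E_A^\infty$ is the set of infinite such sequences, with the product topology and one-sided shift $\sigma$; $[w]$ is the cylinder of $\omega\in E_A^\infty$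 beginning with $w$; $\omega|_n=\omega_1\dots\omega_n$. For $w\in E_A^n$: $t(w)=t(w_n)$, $\sigma(w)=w_2\dots w_n$, $\phi_w=\phi_{w_1}\circ\cdots\circ\phi_{w_n}$, and $\phi$ of the empty word is the identity. $\pi:E_A^\infty\to X$ is defined by $\{\pi(\omega)\}=\bigcap_n\phi_{\omega|_n}(X_{t(\omega|_n)})$. $\Phi$ is finitely irreducible if there is a finite set $I\subseteq E_A^*$ such that for all $e,f\in E$ some $\tau\in I$ has $e\tau f\in E_A^*$. Families. A family $F=\{f_e:X_{t(e)}\to\mathbb R\}_{e\in E}$ is Hölder if for some $\beta>0$, $\sup_{n\ge1}\sup_{w\in E_A^n}\sup_{x,y\in X_{t(w)}}|f_{w_1}(\phi_{\sigma(w)}(x))-f_{w_1}(\phi_{\sigma(w)}(y))|e^{\beta n}<\infty$. It is comparable to $\log\Phi'$ if there are $\alpha>0$ and $b,\gamma\in\mathbb R$ with $-\alpha\log|\phi_e'|+\gamma\le f_e\le-\alpha\log|\phi_e'|+b$ for all $e$; this implies that $F$ is uniformly bounded below. The amalgamated function of $F$ is $\tilde f(\omega)=f_{\omega_1}(\pi(\sigma(\omega)))$; that of $\log\Phi'=\{\log|\phi_e'|\}_e$ is $\Xi_\Phi(\omega)=\log|\phi_{\omega_1}'(\pi(\sigma(\omega)))|$. Put $f_{t,q}=t\,\Xi_\Phi+q\tilde f$. Pressure. For a family $G=\{g_e\}$ and $w\in E_A^n$, $S_w(G)=\sum_{j=1}^n g_{w_j}\circ\phi_{\sigma^j(w)}$.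 The pressure is $P(t)=\lim_{n\to\infty}\frac1n\log\sum_{w\in E_A^n}\|\exp S_w(t\log\Phi')\|_{X_{t(w)}}\in(-\infty,\infty]$, with sup norms, and the Bowen parameter is $h=\inf\{t\ge0:P(t)\le0\}$. The Manhattan region is $D=\{(t,q)\in\mathbb R^2:\sum_{e\in\mathbb N}\|\exp(f_e)\|_{X_{t(e)}}^q\,\||\phi_e'|\|_{X_{t(e)}}^t<\infty\}$. Measures. A Gibbs state for $\varphi:E_A^\infty\to\mathbb R$ is a Borel probability measure $m$ on $E_A^\infty$ for which there are $P\in\mathbb R$, $C\ge1$ with $C^{-1}\le m([w])/\exp(\sum_{j=0}^{|w|-1}\varphi(\sigma^j\rho)-P|w|)\le C$ for all $w\in E_A^*$, $\rho\in[w]$. For $(t,q)\in D$, $\tilde\mu_{t,q}$ is the unique $\sigma$-invariant Gibbs state of $f_{t,q}$. The terms of the sequence $\{\tilde\mu_{t,q_n}\}$ are considered for those (all sufficiently large) $n$ with $(t,q_n)\in D$. *)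

(* Defs.v *)
From HB Require Import structures.
From mathcomp Require Import all_boot all_order all_algebra.
From mathcomp Require Import all_classical all_reals all_analysis.

Set Implicit Arguments.
Unset Strict Implicit.
Unset Printing Implicit Defensive.

Import Order.TTheory GRing.Theory Num.Theory.
Import numFieldNormedType.Exports.

Local Open Scope classical_set_scope.
Local Open Scope ring_scope.

Section Conformal.
Context {R : realType} {d : nat}.
Implicit Types (f g : 'rV[R]_d -> 'rV[R]_d) (U : set 'rV[R]_d).

(* The library norm of 'rV[R]_d is the sup norm; it induces the usual topology
   and differential calculus, but conformality and contraction refer to the
   Euclidean norm. *)
Definition enorm (v : 'rV[R]_d) : R := Num.sqrt (\sum_i v 0 i ^+ 2).

Definition scaling f (x : 'rV[R]_d) : R :=
  sup [set enorm ('d f x v) | v in [set v | enorm v = 1]].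

Definition C1_on f U :=
  forall x, U x -> differentiable f x /\ {for x, continuous (jacobian f)}.

Definition diffeo_on f U :=
  [/\ open U, open (f @` U), C1_on f U &
      exists g, (forall x, U x -> g (f x) = x) /\ C1_on g (f @` U)].

Definition conformal_on f U :=
  forall x, U x -> 0 < scaling f x /\
    forall v, enorm ('d f x v) = scaling f x * enorm v.

Definition contracting_on (s : R) f U :=
  forall x y, U x -> U y -> enorm (f x - f y) <= s * enorm (x - y).

End Conformal.

(* A copy of the set B indexed by v; a disjoint union of sets of points of T
   indexed by V is a set of such pairs. *)
Definition disjoint_copy {V T : Type} (v : V) (B : set T) : set (V * T) :=
  [set (v, x) | x in B].

(* The matrix A, with at least one 1 in each row; the alphabet is nat. *)
Record incidence := Incidence {
  inc_mx :> rel nat;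
  inc_row : forall a, exists b, inc_mx a b }.

(* [phi e] is a total function on 'rV[R]_d, of which only the values on
   [Wset (ter e)] matter: its restriction to [Xset (ter e)] is the map
   X_{t(e)} -> X_{i(e)} and its restriction to [Wset (ter e)] is the conformal
   extension of that map.  As X_v is the closure of its interior and W_v is an
   open neighborhood of X_v, the derivative on X_v depends only on the
   restriction of [phi e] to X_v. *)
Record CGDMS (R : realType) (d : nat) := {
  vertex : finType;
  ini : nat -> vertex;
  ter : nat -> vertex;
  inc : incidence;
  inc_compat : forall a b, inc a b -> ter a = ini b;
  Xset : vertex -> set 'rV[R]_d;
  Xset_neq0 : forall v, Xset v !=set0;
  Xset_compact : forall v, compact (Xset v);
  Xset_regular : forall v, Xset v = closure (interior (Xset v));
  phi : nat -> 'rV[R]_d -> 'rV[R]_d;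
  phi_maps : forall e, phi e @` Xset (ter e) `<=` Xset (ini e);
  (* the images lie in the disjoint copies X_{i(a)} and X_{i(b)} *)
  phi_open_set_condition : forall a b, a <> b ->
    disjoint_copy (ini a) (phi a @` interior (Xset (ter a))) `&`
    disjoint_copy (ini b) (phi b @` interior (Xset (ter b))) = set0;
  Wset : vertex -> set 'rV[R]_d;
  Wset_spec : forall v,
    [/\ open (Wset v), connected (Wset v), bounded_set (Wset v) &
        Xset v `<=` Wset v];
  phi_diffeo : forall e, diffeo_on (phi e) (Wset (ter e));
  phi_conformal : forall e, conformal_on (phi e) (Wset (ter e));
  phi_contracting : exists2 s : R, s < 1 &
    forall e, contracting_on s (phi e) (Wset (ter e));
  phi_distortion : exists L kappa : R, [/\ 1 <= L, 0 < kappa &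
    forall e x y, Wset (ter e) x -> Wset (ter e) y ->
      `| scaling (phi e) y - scaling (phi e) x |
        <= L * scaling (phi e) x * (enorm (y - x) `^ kappa)] }.

Section Symbolic.
Variable A : incidence.

Definition admissible : set (seq nat) := [set w | sorted A w].

Definition words (n : nat) : set (seq nat) :=
  [set w | size w = n /\ admissible w].

(* Letters of infinite sequences are indexed from 0. *)
Definition admissible_seq : set (prod_topology (fun _ : nat => nat)) :=
  [set w | forall k, A (w k) (w k.+1)].

(* E_A^oo, with the topology induced by the product of discrete topologies. *)
Definition EA : Type := admissible_seq.

HB.instance Definition _ := Topological.on EA.

Definition letter (w : EA) (k : nat) : nat := set_val w k.

Lemma EA_inhabited : exists w : EA, True.
Proof.
pose w k := iter k (fun a => projT1 (cid (@inc_row A a))) 0%N.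
suff wA : admissible_seq w by exists (exist _ w (mem_set wA)).
by move=> k; rewrite /w /=; case: cid.
Qed.

HB.instance Definition _ := isPointed.Build EA (projT1 (cid EA_inhabited)).

Definition EAborel := g_sigma_algebraType (@open EA).

HB.instance Definition _ := Measurable.on EAborel.

Lemma shift_subproof (w : EA) :
  (fun k => letter w k.+1 : nat) \in admissible_seq.
Proof.
by apply: mem_set => k; have := set_mem (svalP w); exact.
Qed.

Definition shift (w : EA) : EA := SigSub (shift_subproof w).

Definition restr (w : EA) (n : nat) : seq nat := mkseq (letter w) n.

Definition cylinder (u : seq nat) : set EA := [set w | restr w (size u) = u].

Definition finitely_irreducible := exists I : seq (seq nat),
  (forall u, u \in I -> admissible u) /\
  forall e f : nat, exists2 u, u \in I & admissible (e :: u ++ [:: f]).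

Context {R : realType}.
Implicit Types m : probability EAborel R.

Definition shift_invariant m :=
  forall B : set EAborel, measurable B -> m (shift @^-1` B) = m B.

Definition gibbs_state (g : EA -> R) m := exists P C : R, 1 <= C /\
  forall u, admissible u -> forall rho, cylinder u rho ->
    C^-1 <= fine (m (cylinder u)) /
      expR (\sum_(j < size u) g (iter j shift rho) - P * (size u)%:R) <= C.

(* The weak* topology: the topology of pointwise convergence of the functionals
   that the measures induce on bounded continuous functions. *)
Definition Cb := {g : EA -> R | continuous g /\ bounded_fun g}.

HB.instance Definition _ := gen_eqMixin Cb.
HB.instance Definition _ := gen_choiceMixin Cb.

Definition functional m : prod_topology (fun _ : Cb => R) :=
  fun g => \int[m]_(x in setT) sval g x.

Definition weakstar := initial_topology functional.

End Symbolic.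

Section System.
Context {R : realType} {d : nat} (Phi : CGDMS R d).

Definition fun_family := nat -> 'rV[R]_d -> R.
Implicit Types G f : fun_family.

Notation A := (inc Phi).

(* t(w), for a nonempty word w *)
Definition word_ter (w : seq nat) : vertex Phi := ter Phi (last 0%N w).

Definition phi_word (w : seq nat) : 'rV[R]_d -> 'rV[R]_d :=
  foldr (fun e g => phi Phi e \o g) id w.

(* pi(w), as a point of the copy of X_{i(w_1)} in the disjoint union *)
Definition coding (w : EA A) : 'rV[R]_d :=
  xget 0 (\bigcap_(n in [set n | (0 < n)%N])
    (phi_word (restr w n) @` Xset (word_ter (restr w n)))).

Definition dphi : fun_family := fun e => scaling (phi Phi e).

Definition log_dphi : fun_family := fun e x => ln (dphi e x).

Definition amalgamated G (w : EA A) : R :=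
  G (letter w 0) (coding (shift w)).

Definition holder_family f := exists2 beta : R, 0 < beta &
  exists M : R, forall n w, (0 < n)%N -> words A n w ->
    forall x y, Xset (word_ter w) x -> Xset (word_ter w) y ->
      `| f (head 0%N w) (phi_word (behead w) x)
         - f (head 0%N w) (phi_word (behead w) y) | * expR (beta * n%:R) <= M.

Definition comparable_to_log_dphi f := exists alpha b gamma : R,
  0 < alpha /\ forall e x, Xset (ter Phi e) x ->
    - alpha * log_dphi e x + gamma <= f e x <= - alpha * log_dphi e x + b.

Definition supnorm (B : set 'rV[R]_d) (g : 'rV[R]_d -> R) : R :=
  sup [set `|g x| | x in B].

Definition word_sum G (w : seq nat) (x : 'rV[R]_d) : R :=
  \sum_(j < size w) G (nth 0%N w j) (phi_word (drop j.+1 w) x).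

Definition pressure G : \bar R :=
  lim (((n%:R^-1)%:E * lne (\esum_(w in words A n)
    (supnorm (Xset (word_ter w)) (expR \o word_sum G w))%:E))%E @[n --> \oo]).

Definition bowen : \bar R := ereal_inf [set t%:E | t in
  [set t : R | 0 <= t /\ (pressure (fun e x => t * log_dphi e x)%R <= 0)%E]].

Definition manhattan f : set (R * R) := [set tq |
  (\sum_(0 <= e <oo)
     ((supnorm (Xset (ter Phi e)) (expR \o f e)) `^ tq.2 *
      (supnorm (Xset (ter Phi e)) (dphi e)) `^ tq.1)%:E < +oo)%E].

Definition potential f (t q : R) (w : EA A) : R :=
  t * amalgamated log_dphi w + q * amalgamated f w.

Definition integral_amalgamated f (m : probability (EAborel A) R) : \bar R :=
  \int[m]_(w in setT) (amalgamated f w)%:E.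

Definition xi_min f : \bar R := ereal_inf
  [set integral_amalgamated f nu | nu in
    [set nu : probability (EAborel A) R | shift_invariant nu]].

End System.

(* Main.v *)
Require Import Defs.
From HB Require Import structures.
From mathcomp Require Import all_boot all_order all_algebra.
From mathcomp Require Import all_classical all_reals all_analysis.
From mathcomp Require Import measurable_realfun ring lra.

Set Implicit Arguments.
Unset Strict Implicit.
Unset Printing Implicit Defensive.

Import Order.TTheory GRing.Theory Num.Theory.
Import numFieldNormedType.Exports.

Local Open Scope classical_set_scope.
Local Open Scope ring_scope.

(** Let [F] be the amalgamated function of the family and [Xi] that of
    [log Phi'], so that the potentials are [t * Xi + q * F] with [q] tending to
    minus infinity. The theorem is a zero-temperature limit: entropy and
    [t * Xi] are controlled by the integral of [F] with constants independent
    of [q], so for large [- q] a Gibbs state must have nearly the least possible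
    integral of [F].

    Two inequalities express this for a Gibbs state [m] with pressure [P].
    Cylinders have mass at most 1, so every Birkhoff sum of length [n] is at most
    [n * P] plus a constant, and [P] is at least the integral of the potential
    against any invariant [nu] ([gibbs_pressure_ge]). In the other direction,
    [P] is at most the [m]-integral of the potential minus [ln (p w_0)], for any
    weights [p] on the letters with sum at most 1 ([gibbs_integral_le]). This is
    the bound of the entropy of [m] by its cross entropy with a Bernoulli weight;
    it follows from [ln x <= x - 1] at the quotient of [p w_0 ... p w_(n-1)] by
    the mass of the cylinder of [w_0 ... w_(n-1)], whose [m]-integral is at most
    1 ([integral_word_ratio_le1]). If [- ln (p w_0)] and [- Xi] are at most
    [k * F + c], the two inequalities combine into
    [(- q - k) * int F dm <= (t * k - q) * int F dnu + c + t * c]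
    ([gibbs_integral_compare]), and letting [q] tend to minus infinity bounds the
    upper limit of the integrals of [F] by that of any invariant [nu].

    Taking for [nu] one of the Gibbs states shows that these integrals stay
    bounded. Since [F] is large when the first letter is large, Markov's
    inequality and invariance make the sequence tight ([gibbs_tight]), so
    Prokhorov's theorem gives an accumulation point. It is obtained by taking
    limits along an ultrafilter of the masses of clopen sets and extending the
    resulting premeasure ([prokhorov_ultrafilter]). Invariance passes to the
    limit, and so do upper bounds on the integral of the nonnegative continuous
    function [F] minus its lower bound; the limit is therefore minimizing
    ([zero_temperature_limit]).

    The geometry provides the weights: [p e] is proportional to the power
    [d + 2] of the supremum of [|phi_e'|]. The sum of these powers is finite
    ([dphi_summable]) because [phi_e (Int X)] contains a cube of size comparable
    to [|phi_e'|] ([image_contains_box]), these cubes are disjoint, and a bounded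
    region has room for at most a multiple of [N ^ d] of them of size [1 / N]
    ([card_scale_le]). The same sum shows that [(t, q)] lies in the Manhattan
    region for all very negative [q] ([manhattan_near]), and the Hoelder
    condition makes [F] continuous ([amalgamated_continuous]). *)

(** * Limits along ultrafilters and a form of Fatou's lemma *)

Lemma ultra_bounded_cvg (R : realType) (I : Type) (U : set_system I)
    {UU : UltraFilter U} (u : I -> R) (a b : R) :
  (forall n, a <= u n <= b) -> cvg (u @ U).
Proof.
move=> uab.
have UF : ProperFilter U by exact: ultra_proper.
have Uab : (u @ U) `[a, b]%classic.
  by apply: nearW => n; rewrite /= in_itv /=; exact: uab.
have [p [_ pcl]] := @segment_compact R a b (u @ U) _ Uab.
apply: (cvgP p) => V pV /=.
have [//|UV] := in_ultra_setVsetC (u @^-1` V) UU.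
by have [y []] := pcl (~` V) V UV pV.
Qed.

Lemma cvg_sum_ord (R : realType) (I : Type) (U : set_system I) {UF : ProperFilter U}
    (m : nat) (u : nat -> I -> R) (l : nat -> R) :
  (forall k, u k @ U --> l k) ->
  \sum_(k < m) u k i @[i --> U] --> \sum_(k < m) l k.
Proof.
move=> ul; elim: m => [|m IH].
  by rewrite big_ord0; under eq_fun do rewrite big_ord0; exact: cvg_cst.
rewrite big_ord_recr /=; under eq_fun do rewrite big_ord_recr /=.
exact: cvgD.
Qed.

Lemma fatou_le d (T : measurableType d) (R : realType) (m : {measure set T -> \bar R})
    (f : T -> R) (u : nat -> T -> R) (c : R) :
  (forall k, measurable_fun setT (u k)) -> (forall k x, 0 <= u k x) ->
  (forall x, u k x @[k --> \oo] --> f x) ->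
  (forall k, \int[m]_x (u k x)%:E <= c%:E)%E -> (\int[m]_x (f x)%:E <= c%:E)%E.
Proof.
move=> mu u0 uf uc.
apply: (@le_trans _ _ (limn_einf (fun k => \int[m]_x (u k x)%:E)%E)).
  have -> : (\int[m]_x (f x)%:E = \int[m]_x limn_einf (fun k => (u k x)%:E))%E.
    apply: eq_integral => x _.
    have ufx : (u k x)%:E @[k --> \oo] --> (f x)%:E.
      by apply: cvg_EFin; [exact: nearW|exact: uf].
    by rewrite is_cvg_limn_einfE; [apply/esym/cvg_lim|apply: cvgP ufx].
  apply: (fatou m measurableT) => [k|k x _]; first exact/measurable_EFinP.
  by rewrite lee_fin.
rewrite limn_einf_lim; apply: lime_le; first exact: is_cvg_einfs.
apply: nearW => k; apply: ge_ereal_inf.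
by exists (\int[m]_x (u k x)%:E)%E => //; exists k => /=.
Qed.

(** * Staircase approximations by superlevel sets *)

Section staircase.
Context (R : realType).
Implicit Types (x d : R).

(** The value of [x] rounded down to the grid of step [d], cut off at [N * d], and
    written as a sum over the levels below [x]: composed with a function it is a
    combination of indicators of open superlevel sets, whose masses are
    semicontinuous under weak limits. *)
Definition stair d N x : R := \sum_(i < N) d * (i.+1%:R * d < x)%R%:R.

Lemma stair_ge0 d N x : 0 <= d -> 0 <= stair d N x.
Proof. by move=> d0; apply: sumr_ge0 => i _; rewrite mulr_ge0. Qed.

Lemma stair_le d N x : 0 <= d -> 0 <= x -> stair d N x <= x.
Proof.
move=> d0 x0; suff : stair d N x <= x /\ stair d N x <= N%:R * d by case.
elim: N => [|N [IH1 IH2]]; first by rewrite /stair big_ord0 mul0r.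
rewrite /stair big_ord_recr /= -/(stair d N x).
case: ltP => h; rewrite ?mulr1 ?mulr0 ?addr0; split=> //.
- by apply: ltW; apply: le_lt_trans h; rewrite -natr1 mulrDl mul1r lerD2r.
- by rewrite -natr1 mulrDl mul1r lerD2r.
- by apply: (le_trans IH2); rewrite ler_wpM2r// ler_nat.
Qed.

Lemma stair_ge d N x : 0 <= d -> x <= N%:R * d -> x <= d + stair d N x.
Proof.
move=> d0; elim: N => [|N IH].
  by rewrite mul0r /stair big_ord0 addr0 => /le_trans; exact.
have [xN _|Nx xN1] := leP x (N%:R * d).
  apply: (le_trans (IH xN)); rewrite lerD2l /stair big_ord_recr /= lerDl.
  by rewrite mulr_ge0.
apply: (le_trans xN1).
have -> : N.+1%:R * d = d + N%:R * d by rewrite -natr1 mulrDl mul1r addrC.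
rewrite lerD2l.
rewrite /stair big_ord_recr /=.
have -> : \sum_(i < N) d * (i.+1%:R * d < x)%R%:R = N%:R * d.
  transitivity (\sum_(i < N) d); last by rewrite sumr_const card_ord mulr_natl.
  apply: eq_bigr => i _; rewrite (_ : _ < x) ?mulr1//; apply: le_lt_trans Nx.
  by rewrite ler_wpM2r// ler_nat.
by rewrite lerDl mulr_ge0.
Qed.

End staircase.

(** * Prokhorov's theorem on zero-dimensional spaces *)

(** An alias of [T] on which the measurable sets are the clopen sets; they form
    an algebra, the domain of the premeasure to be extended. *)
Definition clopen_algebra (T : ptopologicalType) : Type := T.

Section clopen_algebra.
Context (T : ptopologicalType).

Let clopen_set0 : (@clopen T) set0. Proof. by split; [exact: open0|exact: closed0]. Qed.

Let clopen_setU : setU_closed (@clopen T).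
Proof. by move=> A B [oA cA] [oB cB]; split; [exact: openU|exact: closedU]. Qed.

Let clopen_setC : setC_closed (@clopen T).
Proof. by move=> A [oA cA]; split; [exact: closed_openC|exact: open_closedC]. Qed.

HB.instance Definition _ := Pointed.on (clopen_algebra T).
HB.instance Definition _ := isAlgebraOfSets.Build default_measure_display
  (clopen_algebra T) clopen_set0 clopen_setU clopen_setC.

End clopen_algebra.

Section weak_limit.
Context (R : realType) (T : ptopologicalType).
Notation borel := (g_sigma_algebraType (@open T)).
Context (B : nat -> set T).
Hypothesis clopenB : forall j, clopen (B j).
Hypothesis baseB : forall (O : set T) x, open O -> O x ->
  exists j, B j x /\ B j `<=` O.
Context (mu : nat -> probability borel R).
Context (U : set_system nat) {UU : UltraFilter U}.
Hypothesis tight : forall e : R, 0 < e -> exists K : set T,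
  [/\ compact K, closed K & \forall n \near U, (mu n (~` K) <= e%:E)%E].

Let UF : ProperFilter U. Proof. exact: ultra_proper. Qed.
#[local] Existing Instance UF.

Let measurable_open (O : set T) : open O -> measurable (O : set borel).
Proof. by move=> oO; apply: sub_sigma_algebra. Qed.

Definition ulim (A : set T) : R := lim (fine (mu n A) @[n --> U]).

Let fin_mu n (A : set T) : measurable (A : set borel) -> mu n A \is a fin_num.
Proof. by move=> mA; apply: fin_num_measure. Qed.

Let mu01 (A : set T) : measurable (A : set borel) -> forall n, 0 <= fine (mu n A) <= 1.
Proof.
move=> mA n; rewrite fine_ge0 ?measure_ge0//=.
by rewrite -lee_fin fineK ?fin_mu// probability_le1.
Qed.

Lemma cvg_ulim (A : set T) : measurable (A : set borel) ->
  fine (mu n A) @[n --> U] --> ulim A.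
Proof. by move=> mA; apply: (ultra_bounded_cvg (mu01 mA)). Qed.

Lemma ulim_ge0 (A : set T) : measurable (A : set borel) -> 0 <= ulim A.
Proof.
move=> mA; apply: limr_ge; first exact: (cvgP _ (cvg_ulim mA)).
by apply: nearW => n; case/andP: (mu01 mA n).
Qed.

(** Truncated at 0 because a content is a nonnegative function on all sets, whereas
    [ulim A] is unspecified when [A] is not Borel. *)
Definition ulim_ext (A : set (clopen_algebra T)) : \bar R :=
  (Num.max 0 (ulim A))%:E.

Let ulim_extE (A : set T) : measurable (A : set borel) -> ulim_ext A = (ulim A)%:E.
Proof. by move=> mA; rewrite /ulim_ext max_r// ulim_ge0. Qed.

Let mclopen (A : set T) : clopen A -> measurable (A : set borel).
Proof. by case=> oA _; exact: measurable_open. Qed.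

Let ulim0 : ulim set0 = 0.
Proof.
apply: cvg_lim => //; under eq_fun do rewrite measure0 /=; exact: cvg_cst.
Qed.

Let ulim_ext_ge0 A : (0 <= ulim_ext A)%E.
Proof. by rewrite lee_fin le_max lexx. Qed.

Let ulim_ext_additive : measure_function.semi_additive ulim_ext.
Proof.
apply/additive2P; first by rewrite /ulim_ext ulim0 maxxx.
move=> A C cA cC AC0; have [mA mC] := (mclopen cA, mclopen cC).
rewrite !ulim_extE//; last exact: measurableU.
rewrite -EFinD; congr EFin.
apply: cvg_lim => //.
have -> : (fun n => fine (mu n (A `|` C))) = (fun n => fine (mu n A) + fine (mu n C)).
  apply/funext => n; rewrite -fineD ?fin_mu// -measureU//.
by apply: cvgD; exact: cvg_ulim.
Qed.

HB.instance Definition _ := isContent.Build _ _ _ ulim_ext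
  ulim_ext_ge0 ulim_ext_additive.

(** Tightness is what makes the limit countably subadditive: inside a compact set a
    clopen set needs only finitely many of the covering sets, and finite
    subadditivity passes to the limit, while the mass outside the compact set is at
    most [e] uniformly along [U]. *)
Let ulim_ext_sub : measurable_subset_sigma_subadditive ulim_ext.
Proof.
move=> X A mA' mX' XA.
have cA k : clopen (A k) by exact: mA'.
have cX : clopen X by exact: mX'.
have mA k : measurable (A k : set borel) by exact: (mclopen (cA k)).
have mX : measurable (X : set borel) by exact: (mclopen cX).
rewrite ulim_extE//.
apply/lee_addgt0Pr => e e0.
have [K [cK clK muK]] := tight e0.
have : compact (K `&` X) by apply: compact_closedI => //; case: cX.
rewrite compact_cover => /(_ nat setT A) [|x [_ Xx]|D _ KXD].
- by move=> i _; case: (cA i).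
- by have [i _ Aix] := XA _ Xx; exists i.
pose m := (\max_(i <- finmap.enum_fset D) i).+1.
have XV : X `<=` \big[setU/set0]_(k < m) A k `|` ~` K.
  move=> x Xx; have [Kx|] := pselect (K x); last by right.
  have [i /= iD Aix] := KXD _ (conj Kx Xx).
  left; rewrite -bigcup_mkord; exists i => //=.
  by rewrite /m ltnS; exact: (@leq_bigmax_seq _ (finmap.enum_fset D) xpredT id i iD).
apply: (@le_trans _ _ (\sum_(k < m) ulim_ext (A k) + e%:E)%E); last first.
  rewrite leeD2r// -(big_mkord xpredT (fun k => ulim_ext (A k))).
  by apply: nneseries_lim_ge => k _ _; exact: ulim_ext_ge0.
under eq_bigr do rewrite ulim_extE//.
rewrite sumEFin -EFinD lee_fin.
have cvgs : \sum_(k < m) fine (mu n (A k)) + e @[n --> U] --> \sum_(k < m) ulim (A k) + e.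
  apply: cvgD; last exact: cvg_cst.
  apply: (@cvg_sum_ord _ _ U _ m (fun k n => fine (mu n (A k)))
    (fun k => ulim (A k))) => k.
  exact: cvg_ulim.
apply: (ler_cvg_to (cvg_ulim mX) cvgs).
apply: filterS muK => n muK.
rewrite -lee_fin fineK ?fin_mu//.
rewrite EFinD -sumEFin.
under eq_bigr do rewrite fineK ?fin_mu//.
have mV : measurable (\big[setU/set0]_(k < m) A k : set borel).
  by apply: bigsetU_measurable.
have mK : measurable (~` K : set borel) by apply: measurable_open; exact: closed_openC.
apply: (@le_trans _ _ (mu n (\big[setU/set0]_(k < m) A k `|` ~` K))).
  by apply: le_measure; rewrite ?inE//; exact: measurableU.
apply: (le_trans (measureU2 _ _ _)) => //.
apply: leeD => //.
by apply: Boole_inequality => k _.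
Qed.

HB.instance Definition _ := Content_SigmaSubAdditive_isMeasure.Build _ _ _ ulim_ext
  ulim_ext_sub.

Let open_clopen_cover (O : set T) : open O ->
  O = \bigcup_j (if `[< B j `<=` O >] then B j else set0).
Proof.
move=> oO; apply/seteqP; split=> x.
- by move=> /(baseB oO)[j [Bx BO]]; exists j => //; case: asboolP.
- by move=> [j _]; case: asboolP => // BO /BO.
Qed.

(** An open set is the countable union of the members of the base inside it. *)
Lemma open_sigma_clopen : <<s @open T >> `<=` <<s @clopen T >>.
Proof.
apply: smallest_sub; first exact: smallest_sigma_algebra.
move=> O oO; rewrite (open_clopen_cover oO).
have [s0 _ sU] := smallest_sigma_algebra setT (@clopen T).
apply: sU => j; case: asboolP => _ //.
by apply: sub_sigma_algebra; exact: clopenB.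
Qed.

Definition limit_measure (A : set borel) : \bar R := measure_extension ulim_ext A.

Let limit0 : limit_measure set0 = 0%E.
Proof. exact: (@measure0 _ _ _ (measure_extension ulim_ext)). Qed.
Let limit_ge0 A : (0 <= limit_measure A)%E.
Proof. exact: (@measure_ge0 _ _ _ (measure_extension ulim_ext)). Qed.
Let limit_sigma : semi_sigma_additive limit_measure.
Proof.
move=> F mF tF mUF.
apply: (@measure_semi_sigma_additive _ _ _ (measure_extension ulim_ext)) => //.
- by move=> i; exact: (open_sigma_clopen (mF i)).
- exact: (open_sigma_clopen mUF).
Qed.

HB.instance Definition _ := isMeasure.Build _ _ _ limit_measure
  limit0 limit_ge0 limit_sigma.

Lemma limit_measure_clopen (A : set T) : clopen A -> limit_measure A = (ulim A)%:E.
Proof.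
move=> cA; rewrite /limit_measure /measure_extension measurable_mu_extE//.
by rewrite -ulim_extE//; exact: mclopen.
Qed.

Let limitT : limit_measure setT = 1%E.
Proof.
rewrite limit_measure_clopen; last exact: clopenT.
congr EFin; apply: cvg_lim => //.
under eq_fun do rewrite probability_setT /=; exact: cvg_cst.
Qed.

HB.instance Definition _ := Measure_isProbability.Build _ _ _ limit_measure limitT.

(** An open set is an increasing union of clopen sets, on which the limit measure is
    the limit of the masses. *)
Lemma limit_measure_open (O : set T) : open O -> (limit_measure O <= (ulim O)%:E)%E.
Proof.
move=> oO; have mO := measurable_open oO.
pose V m : set borel := \bigcup_(j in `I_m) (if `[< B j `<=` O >] then B j else set0).
have cV m : clopen (V m).
  rewrite /V bigcup_mkord; apply: (@bigsetU_measurable _ (clopen_algebra T)) => k _.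
  by case: asboolP => _; [exact: clopenB|split; [exact: open0|exact: closed0]].
have OE : O = \bigcup_m V m.
  rewrite {1}(open_clopen_cover oO); apply/seteqP; split=> x.
  - by move=> [j _ Bx]; exists j.+1 => //; exists j => /=.
  - by move=> [m _ [j _ Bx]]; exists j.
have VO m : V m `<=` O by rewrite OE => x Vx; exists m.
have : limit_measure \o V @ \oo --> limit_measure (\bigcup_m V m).
  apply: nondecreasing_cvg_mu.
  - by move=> m; exact: (mclopen (cV m)).
  - by rewrite -OE.
  - move=> a b ab; apply/subsetPset => x [j /= ja Bx]; exists j => //=.
    exact: leq_trans ab.
rewrite -OE => cvgV.
apply: (cvge_to_le cvgV); apply: nearW => m /=.
rewrite limit_measure_clopen//= lee_fin.
apply: (ler_cvg_to (cvg_ulim (mclopen (cV m))) (cvg_ulim mO)).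
apply: nearW => n; rewrite fine_le ?fin_mu//; first exact: mclopen.
apply: (le_measure _ (mem_set (mclopen (cV m))) (mem_set mO)).
exact: VO.
Qed.

Let measurable_gt (g : T -> R) (c : R) : continuous g ->
  open [set x | c < g x].
Proof.
move=> cg; apply: (@open_comp _ _ g [set y | c < y]) => [x _|]; first exact: cg.
exact: open_gt.
Qed.

Lemma measurable_continuous (g : T -> R) : continuous g ->
  measurable_fun setT (g : borel -> R).
Proof.
move=> cg; apply: (measurability _ (RGenOInfty.measurableE R)) => _ [_ [c ->] <-].
rewrite setTI; apply: measurable_open.
rewrite (_ : _ @^-1` _ = [set x | c < g x]); first exact: measurable_gt.
by apply/seteqP; split => x; rewrite /= in_itv /= andbT.
Qed.

Let integral_stair (m : {measure set borel -> \bar R}) (g : T -> R) d N :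
  continuous g -> 0 <= d ->
  (\int[m]_x (stair d N (g x))%:E =
   \sum_(i < N) d%:E * m [set x | (i.+1%:R * d < g x)%R])%E.
Proof.
move=> cg d0.
pose S i : set borel := [set x | i.+1%:R * d < g x].
have mS i : measurable (S i) by apply: measurable_open; exact: measurable_gt.
have mI i : measurable_fun setT (fun x : borel => d * \1_(S i) x).
  by apply: measurable_funM; [exact: measurable_cst|exact: measurable_indic].
transitivity (\int[m]_x (\sum_(i < N) (d * \1_(S i) x)%:E))%E.
  apply: eq_integral => x _; rewrite sumEFin; congr EFin; apply: eq_bigr => i _.
  rewrite indicE /=; congr (_ * _%:R); congr nat_of_bool.
  by apply/idP/idP => [h|/set_mem//]; apply/mem_set.
rewrite ge0_integral_sum//; last 2 first.
- by move=> i; apply/measurable_EFinP; exact: mI.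
- by move=> i x _; rewrite lee_fin mulr_ge0.
apply: eq_bigr => i _.
under eq_integral do rewrite EFinM.
rewrite ge0_integralZl_EFin//; last by apply/measurable_EFinP; exact: measurable_indic.
by rewrite integral_indic// setIT.
Qed.

Let measurable_stair (g : T -> R) d N : continuous g ->
  measurable_fun setT (fun x : borel => stair d N (g x)).
Proof.
move=> cg; apply: measurable_sum => i.
apply: measurable_funM; first exact: measurable_cst.
rewrite [X in measurable_fun _ X](_ : _ = \1_([set x | i.+1%:R * d < g x] : set borel)).
  apply: measurable_indic; apply: measurable_open; exact: measurable_gt.
apply/funext => x; rewrite indicE; congr (_%:R); congr nat_of_bool.
by apply/idP/idP => [h|/set_mem//]; apply/mem_set.
Qed.

(** Lower semicontinuity of the integral: on staircases of [g] it is the inequality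
    for open superlevel sets, and the staircases increase in precision to [g]. *)
Lemma limit_measure_lsc (g : T -> R) (c : R) : continuous g -> (forall x, 0 <= g x) ->
  (\forall n \near U, \int[mu n]_x (g x)%:E <= c%:E)%E ->
  (\int[limit_measure]_x (g x)%:E <= c%:E)%E.
Proof.
move=> cg g0 gc; have mg := measurable_continuous cg.
(* step 1 / (k + 1), up to height k + 1 *)
pose h k x := stair (k.+1%:R^-1) (k.+1 * k.+1) (g x).
have mh k : measurable_fun setT (h k : borel -> R) by exact: measurable_stair.
have hc k : (\int[limit_measure]_x (h k x)%:E <= c%:E)%E.
  rewrite integral_stair//.
  apply: (@le_trans _ _ (\sum_(i < k.+1 * k.+1)
      (k.+1%:R^-1)%:E * (ulim [set x | i.+1%:R * k.+1%:R^-1 < g x])%:E)%E).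
    apply: lee_sum => i _; rewrite lee_pmul2l//.
    by apply: limit_measure_open; exact: measurable_gt.
  under eq_bigr do rewrite -EFinM; rewrite sumEFin lee_fin.
  set u := fun (i n : nat) => k.+1%:R^-1 * fine (mu n [set x | i.+1%:R * k.+1%:R^-1 < g x]).
  have mi i : measurable ([set x | i.+1%:R * k.+1%:R^-1 < g x] : set borel).
    by apply: measurable_open; exact: measurable_gt.
  have cvgu i : u i @ U --> k.+1%:R^-1 * ulim [set x | i.+1%:R * k.+1%:R^-1 < g x].
    by apply: cvgM; [exact: cvg_cst|exact: (cvg_ulim (mi i))].
  apply: (cvgr_to_le (@cvg_sum_ord _ _ _ _ (k.+1 * k.+1)%N _ _ cvgu)).
  apply: filterS gc => n gn; rewrite -lee_fin; apply: le_trans gn.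
  rewrite -sumEFin.
  have -> : (\sum_(i < k.+1 * k.+1) (u i n)%:E = \sum_(i < k.+1 * k.+1)
      (k.+1%:R^-1)%:E * mu n [set x | (i.+1%:R * k.+1%:R^-1 < g x)%R])%E.
    by apply: eq_bigr => i _; rewrite /u EFinM (fineK (fin_mu n (mi i))).
  rewrite -integral_stair//.
  apply: ge0_le_integral => //.
  - by move=> x _; rewrite lee_fin stair_ge0.
  - by apply/measurable_EFinP; exact: (mh k).
  - exact/measurable_EFinP.
  - by move=> x _; rewrite lee_fin stair_le.
apply: (fatou_le mh) => // [k x|x]; first exact: stair_ge0.
apply/cvgrPdist_le => /= e e0.
near=> k.
have kgx : g x <= (k.+1 * k.+1)%:R * k.+1%:R^-1.
  rewrite natrM mulfK ?gt_eqF// ?ltr0n// -natr1.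
  apply: (@le_trans _ _ k%:R); last by rewrite lerDl.
  by near: k; exact: nbhs_infty_ger.
rewrite ger0_norm ?subr_ge0 ?stair_le//.
rewrite lerBlDr; apply: (le_trans (stair_ge _ kgx)) => //.
by rewrite lerD2r; apply: ltW; near: k; exact: (near_infty_natSinv_lt (PosNum e0)).
Unshelve. all: by end_near. Qed.

Let integrable_bounded (m : probability borel R) (g : T -> R) (M : R) :
  continuous g -> (forall x, `|g x| <= M) -> m.-integrable setT (EFin \o (g : borel -> R)).
Proof.
move=> cg gM; apply: measurable_bounded_integrable => //.
- by rewrite -ge0_fin_numE// fin_num_measure.
- exact: measurable_continuous.
- exists M; split; first exact: num_real.
  by move=> N MN x _; apply: (le_trans (gM x)); exact: ltW.
Qed.

Let integral_shift (m : probability borel R) (g : T -> R) (M : R) :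
  continuous g -> (forall x, `|g x| <= M) ->
  (\int[m]_x (M + g x)%:E)%E = (M + \int[m]_x g x)%:E.
Proof.
move=> cg gM; have ig := integrable_bounded m cg gM.
under eq_integral do rewrite EFinD.
rewrite integralD//; last exact: (finite_measure_integrable_cst m M measurableT).
rewrite EFinD; congr (_ + _)%E.
  by rewrite integral_cst// [X in (_ * X)%E](_ : _ = 1%E) ?mule1//; exact: probability_setT.
by rewrite /Rintegral fineK//; exact: integrable_fin_num.
Qed.

Let limit_measure_bounded_le (g : T -> R) (M l : R) :
  continuous g -> (forall x, `|g x| <= M) ->
  \int[mu n]_x g x @[n --> U] --> l -> \int[limit_measure]_x g x <= l.
Proof.
move=> cg gM gl; apply/ler_addgt0Pr => e e0.
have cMg : continuous (fun x => M + g x).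
  by move=> x; apply: cvgD; [exact: cvg_cst|exact: cg].
have Mg0 x : 0 <= M + g x.
  by rewrite -lerBlDl sub0r; have := gM x; rewrite ler_norml => /andP[].
have := @limit_measure_lsc (fun x => M + g x) (M + (l + e)) cMg Mg0.
rewrite (integral_shift limit_measure cg gM) lee_fin lerD2l; apply.
have : l < l + e by rewrite ltrDl.
move=> /(cvgr_le l gl); apply: filterS => n ln.
by rewrite (integral_shift (mu n) cg gM) lee_fin lerD2l.
Qed.

Lemma limit_measure_bounded (g : T -> R) : continuous g -> bounded_fun g ->
  \int[mu n]_x g x @[n --> U] --> \int[limit_measure]_x g x.
Proof.
move=> cg [M0 [_ gM0]].
have gM x : `|g x| <= M0 + 1 by apply: (gM0 (M0 + 1)) => //; rewrite ltrDl.
set M := M0 + 1 in gM.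
have cNg : continuous (fun x => - 1 * g x).
  by move=> x; apply: cvgM; [exact: cvg_cst|exact: cg].
have NgM x : `|- 1 * g x| <= M by rewrite mulN1r normrN.
have ub n : - M <= \int[mu n]_x g x <= M.
  have ig := integrable_bounded (mu n) cg gM.
  rewrite -ler_norml; apply: (le_trans (le_normr_Rintegral _ _)) => //.
  apply: (@le_trans _ _ (\int[mu n]_x (cst M x))).
    apply: le_Rintegral => //.
    - by have := integrable_abse ig; apply: eq_integrable => //.
    - exact: (finite_measure_integrable_cst (mu n) M measurableT).
  by rewrite Rintegral_cst// [X in fine X](_ : _ = 1%E) ?mulr1//; exact: probability_setT.
pose l := lim (\int[mu n]_x g x @[n --> U]).
have gl : \int[mu n]_x g x @[n --> U] --> l := @ultra_bounded_cvg _ _ _ UU _ _ _ ub.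
suff -> : \int[limit_measure]_x g x = l by exact: gl.
apply/eqP; rewrite eq_le (limit_measure_bounded_le cg gM gl) /=.
rewrite -lerN2.
have -> : - (\int[limit_measure]_x g x) = \int[limit_measure]_x (- 1 * g x).
  by rewrite RintegralZl ?mulN1r//; exact: (integrable_bounded limit_measure cg gM).
apply: (limit_measure_bounded_le cNg NgM).
under eq_fun.
  move=> n; rewrite RintegralZl ?mulN1r//; last exact: (integrable_bounded (mu n) cg gM).
  over.
exact: cvgN.
Qed.

(** Besides weak-star convergence, the conclusion records the convergence on clopen
    sets, which transfers invariance to the limit, and the semicontinuity for
    unbounded nonnegative functions, which transfers bounds on integrals. *)
Theorem prokhorov_ultrafilter : exists nu : probability borel R,
  [/\ (forall A : set T, clopen A -> fine (mu n A) @[n --> U] --> fine (nu A)),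
      (forall g : T -> R, continuous g -> bounded_fun g ->
        \int[mu n]_x g x @[n --> U] --> \int[nu]_x g x) &
      (forall (g : T -> R) (c : R), continuous g -> (forall x, 0 <= g x) ->
        (\forall n \near U, \int[mu n]_x (g x)%:E <= c%:E)%E ->
        (\int[nu]_x (g x)%:E <= c%:E)%E)].
Proof.
exists limit_measure; split.
- move=> A cA; have -> : fine (limit_measure A) = ulim A.
    exact: (congr1 fine (limit_measure_clopen cA)).
  by apply: cvg_ulim; exact: mclopen.
- exact: limit_measure_bounded.
- exact: limit_measure_lsc.
Qed.

End weak_limit.

(** * The topology of the symbolic space *)

Section symbolic_topology.
Context (A : incidence).
Implicit Types (w v : EA A) (n k : nat).

Lemma cylinder_restrP w n v :
  cylinder (restr w n) v <-> forall k, (k < n)%N -> letter v k = letter w k.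
Proof.
rewrite /cylinder /= /restr size_mkseq; split=> [vw k kn|vw].
  have := congr1 (nth 0%N ^~ k) vw; rewrite /= !nth_mkseq//.
by apply: (@eq_from_nth _ 0%N); rewrite !size_mkseq// => k kn; rewrite !nth_mkseq// vw.
Qed.

Lemma cylinder_restr w n : cylinder (restr w n) w.
Proof. exact/cylinder_restrP. Qed.

Lemma restr_admissible w n : admissible A (restr w n).
Proof.
have wA k : A (letter w k) (letter w k.+1).
  exact: (set_mem (svalP w)).
case: n => // n; apply/(sortedP 0%N) => i; rewrite size_mkseq => ilt.
by rewrite !nth_mkseq//; exact: ltnW.
Qed.

Lemma letter_clopen k (S : set nat) : clopen [set w : EA A | S (letter w k)].
Proof.
have opV (V : set nat) : open [set w : EA A | V (letter w k)].
  exists ((fun f : prod_topology (fun _ : nat => nat) => f k) @^-1` V) => //.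
  apply: open_comp; last exact: discrete_open.
  by move=> f _; exact: proj_continuous.
split; first exact: opV.
rewrite -openC (_ : ~` _ = [set w | (~` S) (letter w k)]); first exact: opV.
by [].
Qed.

(** The sets of sequences that agree with [w] on an initial segment generate a filter
    that converges to [w] in the product topology. *)
Lemma open_cylinder (O : set (EA A)) w : open O -> O w ->
  exists n, cylinder (restr w n) `<=` O.
Proof.
move=> [Q oQ <-] /= Ow.
pose agree n := [set f : prod_topology (fun _ : nat => nat) |
  forall k, (k < n)%N -> f k = letter w k].
pose F : set_system (prod_topology (fun _ : nat => nat)) := filter_from setT agree.
have FF : Filter F.
  apply: filter_from_filter; first by exists 0%N.
  move=> i j _ _; exists (maxn i j) => // f fw; split=> k kn; apply: fw;
    by rewrite leq_max kn ?orbT.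
have Fw : F --> (set_val w : prod_topology (fun _ : nat => nat)).
  apply/cvg_sup => k V [V'] [[W oW <-] Ww WV].
  by exists k.+1 => // f fw; apply: WV; rewrite /= (fw k).
have [n _ nO] : F Q by apply: Fw; exact: open_nbhs_nbhs.
exists n => v /cylinder_restrP vw /=; apply: nO => k kn.
exact: vw.
Qed.

Lemma cylinder_clopen u : clopen (cylinder u : set (EA A)).
Proof.
have -> : cylinder u =
    \bigcap_(k in `I_(size u)) [set w : EA A | letter w k = nth 0%N u k].
  apply/seteqP; split=> w.
  - move=> /= wu k /= ku; have := congr1 (nth 0%N ^~ k) wu.
    by rewrite /= nth_mkseq.
  - move=> wu; rewrite /cylinder /=.
    apply: (@eq_from_nth _ 0%N); rewrite !size_mkseq// => k ku.
    by rewrite !nth_mkseq//; exact: wu.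
rewrite bigcap_mkord; apply: big_ind => //.
- exact: clopenT.
- exact: clopenI.
- by move=> k _; exact: (letter_clopen k [set nth 0%N u k]).
Qed.

Lemma open_cylinderP (O : set (EA A)) :
  (forall w, O w -> exists n, cylinder (restr w n) `<=` O) -> open O.
Proof.
move=> OO; rewrite openE => w Ow; have [n nO] := OO w Ow.
rewrite /interior nbhsE; exists (cylinder (restr w n)) => //.
by split; [case: (cylinder_clopen (restr w n))|exact: cylinder_restr].
Qed.

Lemma continuous_cylinderP (R : realType) (g : EA A -> R) :
  (forall w e, 0 < e -> exists n, forall v, cylinder (restr w n) v -> `|g w - g v| <= e) ->
  continuous g.
Proof.
move=> gP w; apply: (proj2 (@cvgrPdist_le _ _ _ _ (@nbhs_filter (EA A) w) g (g w))) => e e0.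
have [n ng] := gP w e e0.
rewrite /= nbhsE /=; exists (cylinder (restr w n)) => //.
by split; [case: (cylinder_clopen (restr w n))|exact: cylinder_restr].
Qed.

Lemma letter_shift w k : letter (Defs.shift w) k = letter w k.+1.
Proof. by []. Qed.

Lemma letter_iter_shift w j k : letter (iter j (@Defs.shift A) w) k = letter w (j + k).
Proof. by elim: j k => [|j IH] k //=; rewrite letter_shift IH addnS. Qed.

Lemma shift_continuous : continuous (@Defs.shift A).
Proof.
apply/continuousP => O oO; apply: open_cylinderP => w Ow.
have [n nO] := open_cylinder oO Ow.
exists n.+1 => v /cylinder_restrP vw; apply: nO; apply/cylinder_restrP => k kn.
by rewrite !letter_shift vw.
Qed.

(** An ultrafilter that contains this set fixes each letter, because it is finitely
    valued; consecutive fixed letters are admissible since they occur together in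
    some sequence, so the fixed letters form a point of the space. *)
Lemma compact_bounded_letters (N : nat -> nat) :
  compact [set w : EA A | forall k, (letter w k <= N k)%N].
Proof.
rewrite compact_ultra => F FU FN.
have FP : ProperFilter F by exact: ultra_proper.
have fixed k : exists a, F [set w | letter w k = a].
  have : F [set w | (letter w k <= N k)%N] by apply: filterS FN => w; exact.
  elim: (N k) => [|m IH] Fm.
    by exists 0%N; apply: filterS Fm => w /=; rewrite leqn0 => /eqP.
  have [Fk|/(filterI Fm) Fk] := in_ultra_setVsetC [set w | letter w k = m.+1] FU.
    by exists m.+1.
  by apply: IH; apply: filterS Fk => w /= [wm /eqP wk]; rewrite -ltnS ltn_neqAle wk.
have [a Fa] := choice fixed.
have aA : admissible_seq A a.
  move=> k; have [w [/= wk wk1]] := filter_ex (filterI (Fa k) (Fa k.+1)).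
  have wA : A (letter w k) (letter w k.+1) := set_mem (svalP w) k.
  by rewrite wk wk1 in wA.
pose w : EA A := exist _ a (mem_set aA).
have Fcyl n : F (cylinder (restr w n)).
  elim: n => [|n IH]; first by apply: filterS filterT => v _; apply/cylinder_restrP.
  apply: filterS (filterI IH (Fa n)) => v [/cylinder_restrP vw vn].
  by apply/cylinder_restrP => k; rewrite ltnS leq_eqVlt => /predU1P[->|/vw].
exists w; split.
  move=> k; have [v [/= vk vN]] := filter_ex (filterI (Fa k) FN).
  by have := vN k; rewrite vk.
move=> V; rewrite nbhsE => -[Q [oQ Qw] QV].
by have [n nQ] := open_cylinder oQ Qw; apply: filterS (Fcyl n) => v /nQ /QV.
Qed.

(** The cylinders, numbered through the countability of the set of words. *)
Definition word_cylinder (j : nat) : set (EA A) :=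
  if unpickle j is Some u then cylinder u else set0.

Lemma word_cylinder_clopen j : clopen (word_cylinder j).
Proof.
rewrite /word_cylinder; case: unpickle => [u|]; first exact: cylinder_clopen.
by split; [exact: open0|exact: closed0].
Qed.

Lemma word_cylinder_base (O : set (EA A)) w : open O -> O w ->
  exists j, word_cylinder j w /\ word_cylinder j `<=` O.
Proof.
move=> oO /(open_cylinder oO)[n nO]; exists (pickle (restr w n)).
by rewrite /word_cylinder pickleK; split; first exact: cylinder_restr.
Qed.

End symbolic_topology.

(** * Invariant measures and Birkhoff sums *)

Section probability_integrals.
Context d (T : measurableType d) (R : realType) (m : probability T R).

(** The constant may be negative and the integrals infinite, so [`|c|] is first added
    to both sides to stay with nonnegative functions. *)
Lemma le_integral_add (f g : T -> R) (c : R) :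
  measurable_fun setT f -> measurable_fun setT g ->
  (forall x, 0 <= f x) -> (forall x, 0 <= g x) -> (forall x, f x <= g x + c) ->
  (\int[m]_x (f x)%:E <= \int[m]_x (g x)%:E + c%:E)%E.
Proof.
move=> mf mg f0 g0 fg.
have shift (h : T -> R) (b : R) : measurable_fun setT h -> (forall x, 0 <= h x) -> 0 <= b ->
    (\int[m]_x (h x + b)%:E = \int[m]_x (h x)%:E + b%:E)%E.
  move=> mh h0 b0; under eq_integral do rewrite EFinD.
  rewrite ge0_integralD//; [|by move=> x _; rewrite lee_fin|exact/measurable_EFinP].
  by rewrite integral_cst// [X in (_ * X)%E](_ : _ = 1%E) ?mule1//; exact: probability_setT.
have cc0 : 0 <= c + `|c| by rewrite -lerBlDr sub0r lerNl -normrN ler_norm.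
suff : (\int[m]_x (f x)%:E + `|c|%:E <=
    \int[m]_x (g x)%:E + c%:E + `|c|%:E)%E by rewrite leeD2rE.
rewrite -addeA -EFinD -(shift f)// -(shift g)//.
apply: ge0_le_integral => //.
- by move=> x _; rewrite lee_fin addr_ge0.
- by apply/measurable_EFinP; apply: measurable_funD.
- by apply/measurable_EFinP; apply: measurable_funD.
- by move=> x _; rewrite lee_fin addrA lerD2r.
Qed.

End probability_integrals.

Section gibbs_inequalities.
Context (R : realType) (A : incidence).
Notation E := (EAborel A).
Notation sigma := (@Defs.shift A).
Implicit Types (m nu : probability E R) (F V : EA A -> R).

Lemma measurable_shift : measurable_fun setT (sigma : E -> E).
Proof.
apply: (@measurability _ _ E E setT sigma (@open (EA A))) => // _ [Q oQ <-].
rewrite setTI; apply: sub_sigma_algebra.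
by move/continuousP : (@shift_continuous A); exact.
Qed.

Lemma measurable_continuousEA F : continuous F -> measurable_fun setT (F : E -> R).
Proof. exact: (@measurable_continuous R (EA A) F). Qed.

Lemma integral_shift_invariant m (h : E -> \bar R) : shift_invariant m ->
  measurable_fun setT h -> (forall x, 0 <= h x)%E ->
  (\int[m]_x h (sigma x) = \int[m]_x h x)%E.
Proof.
move=> inv mh h0.
have := @ge0_integral_pushforward _ _ E E R sigma measurable_shift m setT h measurableT mh.
rewrite preimage_setT => <-; last by move=> x _; exact: h0.
by apply: eq_measure_integral; [exact: measurable_shift|move=> ms B mB _; exact: inv].
Qed.

Lemma continuous_iter_shift F j : continuous F ->
  continuous (fun x => F (iter j sigma x)).
Proof.
move=> cF x; apply: (@continuous_comp _ _ _ (iter j sigma) F); last exact: cF.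
elim: j => [|j IH]; first exact: cvg_id.
by apply: (@continuous_comp _ _ _ (iter j sigma) sigma) => //; exact: shift_continuous.
Qed.

Lemma continuous_scaleEA F (b : R) : continuous F -> continuous (fun x => b * F x).
Proof.
move=> cF x; apply: (@continuous_comp _ _ _ F ( *%R b)); first exact: cF.
exact: mulrl_continuous.
Qed.

Lemma integral_birkhoff m F n : shift_invariant m -> continuous F ->
  (forall x, 0 <= F x) ->
  (\int[m]_x (\sum_(j < n) F (iter j sigma x))%:E =
   n%:R%:E * \int[m]_x (F x)%:E)%E.
Proof.
move=> inv cF F0.
have mi j : measurable_fun setT (fun x : E => (F (iter j sigma x))%:E).
  by apply/measurable_EFinP; apply: measurable_continuousEA; exact: continuous_iter_shift.
have inti j : (\int[m]_x (F (iter j sigma x))%:E = \int[m]_x (F x)%:E)%E.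
  elim: j => [//|j IH]; rewrite -IH.
  rewrite -[RHS](integral_shift_invariant inv)//; last by move=> x; rewrite lee_fin.
  by apply: eq_integral => x _; rewrite iterSr.
under eq_integral do rewrite -sumEFin.
rewrite ge0_integral_sum//; last by move=> j x _; rewrite lee_fin.
under eq_bigr do rewrite inti.
elim: n => [|n IH]; first by rewrite big_ord0 mul0e.
by rewrite big_ord_recr /= IH -natr1 EFinD ge0_muleDl ?lee_fin// mul1e.
Qed.

(** The likelihood ratio of the product weight [p] to [m] on the first [n] letters,
    where the value 0 is given to cylinders of mass 0. *)
Definition word_ratio m (p : nat -> R) n (w : EA A) : R :=
  (\prod_(k < n) p (letter w k)) / fine (m (cylinder (restr w n))).

Lemma measurable_cylinder u : measurable (cylinder u : set E).
Proof. by apply: sub_sigma_algebra; case: (@cylinder_clopen A u). Qed.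

Lemma word_ratio_continuous m p n : continuous (word_ratio m p n).
Proof.
apply: continuous_cylinderP => w e e0; exists n => v /cylinder_restrP vw.
suff -> : word_ratio m p n v = word_ratio m p n w by rewrite subrr normr0 ltW.
have rvw : restr v n = restr w n.
  by apply: (@eq_from_nth _ 0%N); rewrite !size_mkseq// => k kn; rewrite !nth_mkseq// vw.
by rewrite /word_ratio rvw; congr (_ / _); apply: eq_bigr => k _; rewrite vw.
Qed.

Lemma word_ratio_ge0 m (p : nat -> R) n w : (forall e, 0 <= p e) -> 0 <= word_ratio m p n w.
Proof. by move=> p0; rewrite divr_ge0 ?fine_ge0//; exact: prodr_ge0. Qed.

(** On each cylinder the integral of the ratio is the product weight of its word, and
    the product weights of all words of length [n] sum to the [n]-th power of the sum
    of [p]. Only words over the first [N] letters are summed, before [N] tends to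
    infinity. *)
Lemma integral_word_ratio_le1 m (p : nat -> R) n : (forall e, 0 <= p e) ->
  (forall N, \sum_(e < N) p e <= 1) ->
  (\int[m]_w (word_ratio m p n w)%:E <= 1)%E.
Proof.
move=> p0 p1.
pose u N w := word_ratio m p n w * [forall k : 'I_n, (letter w k < N)%N]%:R.
have mr : measurable_fun setT (word_ratio m p n : E -> R).
  by apply: measurable_continuousEA; exact: word_ratio_continuous.
have mu N : measurable_fun setT (u N : E -> R).
  apply: measurable_funM => //.
  apply: measurable_continuousEA; apply: continuous_cylinderP => w e e0.
  exists n => v /cylinder_restrP vw.
  have -> : [forall k : 'I_n, (letter v k < N)%N] =
      [forall k : 'I_n, (letter w k < N)%N].
    by apply: eq_forallb => k; rewrite vw.
  by rewrite subrr normr0 ltW.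
apply: (fatou_le mu) => [N w|w|N].
- by rewrite mulr_ge0// word_ratio_ge0.
- apply: cvg_near_cst; exists (\max_(k < n) letter w k).+1 => // N /= wN.
  rewrite /u (_ : [forall k, _] = true) ?mulr1//; apply/forallP => k.
  apply: leq_trans wN; rewrite ltnS.
  exact: (@leq_bigmax _ (fun k : 'I_n => letter w k) k).
pose word (f : {ffun 'I_n -> 'I_N}) : seq nat := [seq (f k : nat) | k <- enum 'I_n].
pose c (f : {ffun 'I_n -> 'I_N}) := (\prod_(k < n) p (f k)) / fine (m (cylinder (word f))).
have c0 f : 0 <= c f by rewrite divr_ge0 ?fine_ge0//; exact: prodr_ge0.
have mc f : measurable_fun setT (fun w : E => c f * \1_(cylinder (word f) : set E) w).
  apply: measurable_funM; first exact: measurable_cst.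
  by apply: measurable_indic; exact: measurable_cylinder.
apply: (@le_trans _ _ (\int[m]_w (\sum_f (c f * \1_(cylinder (word f) : set E) w)%:E))%E).
  apply: ge0_le_integral => //.
  - by move=> w _; rewrite lee_fin mulr_ge0// word_ratio_ge0.
  - by apply/measurable_EFinP; exact: mu.
  - by apply: emeasurable_sum => f; apply/measurable_EFinP.
  - move=> w _; rewrite sumEFin lee_fin /u; case: forallP => [wN|_]; last first.
      by rewrite mulr0; apply: sumr_ge0 => f _; rewrite mulr_ge0.
    pose f := [ffun k => Ordinal (wN k)].
    have fw : word f = restr w n.
      rewrite /word /restr /mkseq -val_enum_ord -map_comp.
      by apply: eq_map => k; rewrite /= ffunE.
    rewrite mulr1 (bigD1 f)//= indicE fw mem_set; last exact: cylinder_restr.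
    rewrite mulr1 /c /word_ratio fw.
    have -> : \prod_(k < n) p (f k) = \prod_(k < n) p (letter w k).
      by apply: eq_bigr => k _; rewrite ffunE.
    rewrite lerDl; apply: sumr_ge0 => g _.
    by apply: (mulr_ge0 (c0 g)); rewrite indicE.
rewrite ge0_integral_sum//; last 2 first.
- by move=> f; apply/measurable_EFinP; exact: mc.
- by move=> f w _; rewrite lee_fin mulr_ge0.
apply: (@le_trans _ _ (\sum_(f : {ffun 'I_n -> 'I_N}) (\prod_(k < n) p (f k))%:E)%E).
  apply: lee_sum => f _.
  under eq_integral do rewrite EFinM.
  rewrite ge0_integralZl_EFin//; last first.
    by apply/measurable_EFinP; apply: measurable_indic; exact: measurable_cylinder.
  rewrite integral_indic//; last exact: measurable_cylinder.
  have fm : m (cylinder (word f)) = (fine (m (cylinder (word f))))%:E.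
    by rewrite fineK//; apply: fin_num_measure; exact: measurable_cylinder.
  rewrite setIT.
  rewrite [X in (_ * X <= _)%E](_ : _ = (fine (m (cylinder (word f))))%:E);
    last exact: fm.
  rewrite -EFinM lee_fin /c.
  have [->|m0] := eqVneq (fine (m (cylinder (word f)))) 0.
    by rewrite mulr0; exact: prodr_ge0.
  by rewrite divfK.
rewrite sumEFin lee_fin.
rewrite -(@bigA_distr_bigA _ _ _ _ _ _ _ (fun (k : 'I_n) (j : 'I_N) => p j)).
rewrite prodr_const exprn_ile1//.
by apply: sumr_ge0.
Qed.

End gibbs_inequalities.

(** * Pressure inequalities for Gibbs states *)

Lemma le0_of_multiples (R : realType) (x y : R) :
  (forall n : nat, n%:R * x <= y) -> x <= 0.
Proof.
move=> xy; rewrite leNgt; apply/negP => x0.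
have y0 : 0 <= y by have := xy 0%N; rewrite mul0r.
have := archi_boundP (divr_ge0 y0 (ltW x0)).
by rewrite ltr_pdivrMr// ltNge xy.
Qed.

Section gibbs.
Context (R : realType) (A : incidence).
Notation E := (EAborel A).
Notation sigma := (@Defs.shift A).
Implicit Types (m nu : probability E R) (F V : EA A -> R).

(** The defining bounds of a Gibbs state at prefixes of points, multiplied out so that
    they also show that these cylinders have positive mass. *)
Definition gibbs_bounds m V (P C : R) := forall w n,
  let S := \sum_(j < n) V (iter j sigma w) - P * n%:R in
  let M := fine (m (cylinder (restr w n))) in
  expR S <= C * M /\ M <= C * expR S.

Lemma gibbs_stateP m V : gibbs_state V m ->
  exists P C, 1 <= C /\ gibbs_bounds m V P C.
Proof.
move=> [P [C [C1 mC]]]; exists P, C; split => // w n S M.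
have C0 : 0 < C by exact: lt_le_trans ltr01 C1.
have := mC _ (restr_admissible w n) w (cylinder_restr w n).
rewrite size_mkseq -/S -/M => /andP[lo hi]; split.
- by move: lo; rewrite ler_pdivlMr ?expR_gt0// -ler_pdivrMl// invrK.
- by move: hi; rewrite ler_pdivrMr ?expR_gt0.
Qed.

Section upper.
Context m V F (p : nat -> R) (P C b c : R).
Hypotheses (inv : shift_invariant m) (cF : continuous F) (F0 : forall w, 0 <= F w).
Hypotheses (p0 : forall e, 0 < p e) (p1 : forall N, \sum_(e < N) p e <= 1).
Hypotheses (C1 : 1 <= C) (mC : gibbs_bounds m V P C).
Hypotheses (b0 : 0 <= b)
  (bF : forall w, b * F w + c <= ln (p (letter w 0)) - V w).

(** The Gibbs upper bound on cylinder masses makes the logarithm of the word ratio at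
    least the Birkhoff sum of [ln (p w_0) - V] plus [n * P - ln C], and a logarithm is
    at most its argument minus 1. *)
Lemma birkhoff_le_word_ratio w n :
  \sum_(j < n) b * F (iter j sigma w) <= word_ratio m p n w + (ln C - 1 - n%:R * (c + P)).
Proof.
have C0 : 0 < C by exact: lt_le_trans ltr01 C1.
have [] := mC w n.
set S := \sum_(j < n) _ - _; set M := fine _ => lo hi.
have M0 : 0 < M by have := lt_le_trans (expR_gt0 S) lo; rewrite pmulr_rgt0.
have wr : expR (\sum_(k < n) ln (p (letter w k)) - S - ln C) <= word_ratio m p n w.
  rewrite /word_ratio -/M ler_pdivlMr//.
  rewrite 2!expRD 2!expRN lnK ?posrE// expR_sum.
  under eq_bigr do rewrite lnK ?posrE//.
  rewrite -2!mulrA; apply: ler_piMr; first by apply: prodr_ge0 => k _; exact: ltW.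
  by rewrite -invfM ler_pdivrMl ?mulr_gt0 ?expR_gt0// mulr1 mulrC.
(* 1 + x <= exp x, the exponential form of ln x <= x - 1 *)
have := le_trans (expR_ge1Dx _) wr.
have : \sum_(j < n) (b * F (iter j sigma w) + c) <=
       \sum_(j < n) (ln (p (letter w j)) - V (iter j sigma w)).
  by apply: ler_sum => j _; have := bF (iter j sigma w); rewrite letter_iter_shift addn0.
rewrite 2!big_split /= sumr_const card_ord sumrN -mulr_natl /S.
by lra.
Qed.

(** The integral of the preceding inequality is [n] times the claim up to a constant
    independent of [n]. The case [n = 1] shows that the integral is finite. *)
Lemma gibbs_integral_le : (b%:E * \int[m]_w (F w)%:E <= (- (c + P))%:E)%E.
Proof.
have cbF : continuous (fun w => b * F w).
  exact: continuous_scaleEA.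
have bF0 w : 0 <= b * F w by exact: mulr_ge0.
have -> : (b%:E * \int[m]_w (F w)%:E = \int[m]_w (b * F w)%:E)%E.
  rewrite -ge0_integralZl_EFin//.
  - by move=> w _; rewrite lee_fin.
  - by apply/measurable_EFinP; exact: measurable_continuousEA.
have key n : (n%:R%:E * \int[m]_w (b * F w)%:E <= (ln C - n%:R * (c + P))%:E)%E.
  rewrite -integral_birkhoff//.
  have : (\int[m]_x (\sum_(j < n) b * F (iter j sigma x))%:E <=
      \int[m]_x (word_ratio m p n x)%:E + (ln C - 1 - n%:R * (c + P))%:E)%E.
    apply: le_integral_add.
    - apply: measurable_sum => j; apply: measurable_continuousEA.
      exact: (@continuous_iter_shift _ _ (fun w => b * F w)).
    - by apply: measurable_continuousEA; exact: word_ratio_continuous.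
    - by move=> x; apply: sumr_ge0 => j _.
    - by move=> x; apply: word_ratio_ge0 => e; exact: ltW.
    - by move=> x; exact: birkhoff_le_word_ratio.
  move/le_trans; apply.
  have -> : ((ln C - n%:R * (c + P))%:E = 1 + (ln C - 1 - n%:R * (c + P))%:E)%E.
    by rewrite -EFinD; congr EFin; ring.
  by apply: leeD => //; apply: integral_word_ratio_le1 => // e; exact: ltW.
have J0 : (0 <= \int[m]_w (b * F w)%:E)%E by apply: integral_ge0 => w _; rewrite lee_fin.
have Jfin : (\int[m]_w (b * F w)%:E)%E \is a fin_num.
  rewrite ge0_fin_numE//; have := key 1%N; rewrite mul1e => /le_lt_trans; apply.
  exact: ltry.
rewrite -(fineK Jfin) lee_fin -subr_le0 opprK.
apply: (@le0_of_multiples _ _ (ln C)) => n.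
have := key n; rewrite -(fineK Jfin) -EFinM lee_fin.
by rewrite mulrDr; lra.
Qed.

End upper.

(** The Gibbs lower bound on cylinder masses, which are at most 1, bounds the Birkhoff
    sums of [V] by [n * P + ln C] at every point; integrate against [nu] and divide by
    [n]. *)
Lemma gibbs_pressure_ge m nu V F (P C b c : R) : 1 <= C -> gibbs_bounds m V P C ->
  shift_invariant nu -> continuous F -> (forall w, 0 <= F w) ->
  0 <= b -> (forall w, - (b * F w + c) <= V w) ->
  (0 <= b%:E * \int[nu]_w (F w)%:E + (P + c)%:E)%E.
Proof.
move=> C1 mC inv cF F0 b0 bV.
have C0 : 0 < C by exact: lt_le_trans ltr01 C1.
have cbF : continuous (fun w => b * F w).
  exact: continuous_scaleEA.
have bF0 w : 0 <= b * F w by exact: mulr_ge0.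
have -> : (b%:E * \int[nu]_w (F w)%:E = \int[nu]_w (b * F w)%:E)%E.
  rewrite -ge0_integralZl_EFin//.
  - by move=> w _; rewrite lee_fin.
  - by apply/measurable_EFinP; exact: measurable_continuousEA.
have key n : (0 <= n%:R%:E * \int[nu]_w (b * F w)%:E + (ln C + n%:R * (P + c))%:E)%E.
  rewrite -integral_birkhoff//.
  have : (\int[nu]_x (cst 0 x)%:E <= \int[nu]_x (\sum_(j < n) b * F (iter j sigma x))%:E +
       (ln C + n%:R * (P + c))%:E)%E.
    apply: le_integral_add => //.
    - apply: measurable_sum => j; apply: measurable_continuousEA.
      exact: (@continuous_iter_shift _ _ (fun w => b * F w)).
    - by move=> x; apply: sumr_ge0 => j _.
    - move=> x /=; have [lo _] := mC x n.
      have : expR (\sum_(j < n) V (iter j sigma x) - P * n%:R) <= C.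
        apply: (le_trans lo); rewrite ler_piMr ?(ltW C0)//.
        rewrite -lee_fin fineK ?probability_le1//; first exact: measurable_cylinder.
        by apply: fin_num_measure; exact: measurable_cylinder.
      rewrite -[X in _ <= X]lnK ?posrE// ler_expR.
      have : - \sum_(j < n) (b * F (iter j sigma x) + c) <= \sum_(j < n) V (iter j sigma x).
        by rewrite -sumrN; apply: ler_sum => j _; exact: bV.
      by rewrite big_split /= sumr_const card_ord -mulr_natl; lra.
  by rewrite integral0.
have J0 : (0 <= \int[nu]_w (b * F w)%:E)%E by apply: integral_ge0 => w _; rewrite lee_fin.
have [Jfin|Joo] := boolP ((\int[nu]_w (b * F w)%:E)%E \is a fin_num); last first.
  by move: Joo; rewrite ge0_fin_numE// -leNgt leye_eq => /eqP ->; rewrite addye// leey.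
rewrite -(fineK Jfin) lee_fin -oppr_le0.
apply: (@le0_of_multiples _ _ (ln C)) => n.
have := key n; rewrite -(fineK Jfin) -EFinM lee_fin.
by rewrite mulrN !mulrDr; lra.
Qed.

End gibbs.

(** * The zero-temperature limit *)

Section zero_temperature.
Context (R : realType) (A : incidence).
Notation E := (EAborel A).
Notation sigma := (@Defs.shift A).
Implicit Types (m nu : probability E R).
Context (F X : EA A -> R) (p : nat -> R) (k c t : R).
Hypotheses (cF : continuous F) (F0 : forall w, 0 <= F w).
Hypotheses (p0 : forall e, 0 < p e) (p1 : forall N, \sum_(e < N) p e <= 1).
Hypotheses (k0 : 0 <= k) (c0 : 0 <= c) (t0 : 0 <= t).
Hypothesis lnpF : forall w, - ln (p (letter w 0)) <= k * F w + c.
Hypothesis X0 : forall w, X w <= 0.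
Hypothesis XF : forall w, - X w <= k * F w + c.

Let I m := (\int[m]_w (F w)%:E)%E.

Let I0 m : (0 <= I m)%E.
Proof. by apply: integral_ge0 => w _; rewrite lee_fin. Qed.

Let mF : measurable_fun setT (F : E -> R).
Proof. exact: measurable_continuousEA. Qed.

(** Because [t * X <= 0], the potential [t * X + s * F] is at most [s * F], whose slope
    exceeds that of the entropy bound [k * F + c] when [- s > k]. *)
Lemma gibbs_integral_fin m s : shift_invariant m ->
  gibbs_state (fun w => t * X w + s * F w) m -> s < - k -> I m \is a fin_num.
Proof.
move=> inv /gibbs_stateP[P [C [C1 mC]]] sk.
have b0 : 0 < - s - k by rewrite subr_gt0 ltrNr.
have := @gibbs_integral_le _ _ m _ F p P C (- s - k) (- c) inv cF F0 p0 p1 C1 mC (ltW b0).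
move=> /(_ _)/wrap[].
  move=> w; have := lnpF w; have := mulr_ge0_le0 t0 (X0 w); lra.
move=> h; rewrite ge0_fin_numE ?I0// ltey; apply/eqP => Ioo.
by move: h; rewrite -/(I m) Ioo gt0_muley ?lte_fin// leye_eq.
Qed.

(** Elimination of the pressure between the two inequalities. *)
Lemma gibbs_integral_compare m nu s a : shift_invariant m -> shift_invariant nu ->
  gibbs_state (fun w => t * X w + s * F w) m -> s < - k -> I nu = a%:E ->
  (- s - k) * fine (I m) <= (t * k - s) * a + c + t * c.
Proof.
move=> inv invn gm sk nua.
have Ifin := gibbs_integral_fin inv gm sk.
have [P [C [C1 mC]]] := gibbs_stateP gm.
have b0 : 0 < - s - k by rewrite subr_gt0 ltrNr.
have := @gibbs_integral_le _ _ m _ F p P C (- s - k) (- c) inv cF F0 p0 p1 C1 mC (ltW b0).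
move=> /(_ _)/wrap[].
  move=> w; have := lnpF w; have := mulr_ge0_le0 t0 (X0 w); lra.
rewrite -/(I m) -(fineK Ifin) -EFinM lee_fin.
have tks : 0 <= t * k - s.
  by rewrite subr_ge0 (le_trans (ltW sk))// (@le_trans _ _ 0) ?oppr_le0 ?mulr_ge0.
have := @gibbs_pressure_ge _ _ m nu _ F P C (t * k - s) (t * c) C1 mC invn cF F0 tks.
move=> /(_ _)/wrap[].
  by move=> w; have := ler_wpM2l t0 (XF w); lra.
rewrite -/(I nu) nua -EFinM -EFinD lee_fin.
by lra.
Qed.

Context (q : nat -> R) (D : set nat) (mu : nat -> probability E R).
Hypothesis qNy : q n @[n --> \oo] --> -oo.
Hypothesis Dnear : \forall n \near \oo, D n.
Hypothesis muinv : forall n, D n -> shift_invariant (mu n).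
Hypothesis mugibbs : forall n, D n -> gibbs_state (fun w => t * X w + q n * F w) (mu n).

Lemma gibbs_integral_limsup nu : shift_invariant nu -> I nu \is a fin_num ->
  forall e, 0 < e -> \forall n \near \oo, (I (mu n) <= I nu + e%:E)%E.
Proof.
move=> invn nufin e e0.
set a := fine (I nu); have nua : I nu = a%:E by rewrite fineK.
have a0 : 0 <= a by exact: fine_ge0.
(* large enough for the error term in the comparison, divided by - q n - k, to be
   at most e *)
pose K := k + ((t * k + k) * a + c + t * c) / e + 1.
near=> n.
have Dn : D n by near: n.
have qK : q n <= - K by near: n; exact: (cvgrNy_le qNy).
have h0 : 0 <= (t * k + k) * a + c + t * c.
  by rewrite !addr_ge0// !mulr_ge0// addr_ge0// mulr_ge0.
have h1 : 0 <= ((t * k + k) * a + c + t * c) / e by rewrite divr_ge0// ltW.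
have qk : q n < - k by rewrite /K in qK; lra.
have := gibbs_integral_compare (muinv Dn) invn (mugibbs Dn) qk nua.
have := gibbs_integral_fin (muinv Dn) (mugibbs Dn) qk.
move=> Ifin; rewrite -(fineK Ifin) nua -EFinD lee_fin => le1.
have b0 : 0 < - q n - k by lra.
rewrite -(ler_pM2l b0); apply: (le_trans le1).
have : (t * k + k) * a + c + t * c <= (- q n - k) * e.
  by rewrite -ler_pdivrMr//; rewrite /K in qK; lra.
by lra.
Unshelve. all: by end_near. Qed.

(** One Gibbs state of the sequence serves as the competitor for all later ones. *)
Lemma gibbs_integral_bounded : exists2 M : R, 0 <= M &
  \forall n \near \oo, (I (mu n) <= M%:E)%E.
Proof.
have [n [Dn qn]] : exists n, D n /\ q n < - k.
  have : \forall n \near \oo, D n /\ q n < - k.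
    by near=> n; split; near: n => //; exact: (cvgrNy_lt qNy).
  by move=> /filter_ex.
have Ifin := gibbs_integral_fin (muinv Dn) (mugibbs Dn) qn.
exists (fine (I (mu n)) + 1); first by rewrite addr_ge0// fine_ge0.
by rewrite EFinD fineK//; exact: (gibbs_integral_limsup (muinv Dn) Ifin).
Unshelve. all: by end_near. Qed.

Lemma small_weights (L : R) : exists N, forall e, (N < e)%N -> L <= - ln (p e).
Proof.
have cvgp : series p @ \oo --> limn (series p).
  apply: nondecreasing_is_cvgn.
    by apply: nondecreasing_series => n _ _; exact: ltW.
  by exists 1 => _ [n _ <-]; rewrite /series /= big_mkord.
have := cvg_series_cvg_0 cvgp.
move=> /(cvgr_lt 0)/(_ (expR (- L)) (expR_gt0 _))[N _ Np].
exists N => e Ne; rewrite lerNr -ler_expR lnK ?posrE//.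
by apply: ltW; apply: Np => /=; exact: ltnW.
Qed.

(** By invariance the letter at position [j] has the law of the first letter, to which
    Markov's inequality for [k * F + c >= - ln (p w_0)] applies. *)
Lemma gibbs_letter_tail m M N (L : R) : shift_invariant m -> (I m <= M%:E)%E -> 0 < L ->
  (forall e, (N < e)%N -> L <= - ln (p e)) -> forall j,
  (m [set w : EA A | (N < letter w j)%N] <= ((k * M + c) / L)%:E)%E.
Proof.
move=> inv IM L0 NL j.
pose S j : set E := [set w : EA A | (N < letter w j)%N].
have mS i : measurable (S i).
  by apply: sub_sigma_algebra; case: (@letter_clopen A i [set e | (N < e)%N]).
have -> : m (S j) = m (S 0%N).
  elim: j => [//|j <-]; rewrite -(inv (S j))//.
have : (\int[m]_w (L * \1_(S 0%N) w)%:E <= \int[m]_w (k * F w)%:E + c%:E)%E.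
  apply: le_integral_add => //.
  - by apply: measurable_funM; [exact: measurable_cst|exact: measurable_indic].
  - by apply: measurable_funM; [exact: measurable_cst|exact: mF].
  - by move=> w; rewrite mulr_ge0// ltW.
  - by move=> w; rewrite mulr_ge0.
  - move=> w; apply: le_trans (lnpF w); rewrite indicE; case: (boolP (w \in _)).
      by move=> /set_mem wS; rewrite mulr1; exact: NL.
    rewrite mulr0 => _; rewrite oppr_ge0; apply: ln_le0.
    apply: le_trans (p1 (letter w 0).+1); rewrite big_ord_recr /= lerDr.
    by apply: sumr_ge0 => e _; exact: ltW.
under eq_integral do rewrite EFinM.
under [in X in (_ <= X)%E]eq_integral do rewrite EFinM.
have -> : (\int[m]_w (L%:E * (\1_(S 0%N) w)%:E) = L%:E * \int[m]_w (\1_(S 0%N) w)%:E)%E.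
  apply: ge0_integralZl_EFin => //; last exact: ltW.
  by apply/measurable_EFinP; exact: measurable_indic.
have -> : (\int[m]_w (k%:E * (F w)%:E) = k%:E * I m)%E.
  apply: ge0_integralZl_EFin => // [w _|]; first by rewrite lee_fin.
  exact/measurable_EFinP.
rewrite integral_indic// setIT => Lm.
rewrite EFinM lee_pdivlMr// muleC; apply: (le_trans Lm).
by rewrite EFinD leeD// EFinM lee_wpmul2l// lee_fin.
Qed.

Lemma closed_bounded_letters (N : nat -> nat) :
  closed [set w : EA A | forall j, (letter w j <= N j)%N].
Proof.
have -> : [set w : EA A | forall j, (letter w j <= N j)%N] =
    \bigcap_j [set w : EA A | (letter w j <= N j)%N].
  by apply/seteqP; split=> w wN j; [move=> _; exact: wN|exact: wN].
by apply: closed_bigI => j _; case: (@letter_clopen A j [set e | (e <= N j)%N]).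
Qed.

Lemma gibbs_tight e : 0 < e -> exists K : set (EA A),
  [/\ compact K, closed K & \forall n \near \oo, (mu n (~` K) <= e%:E)%E].
Proof.
move=> e0; have [M M0 IM] := gibbs_integral_bounded.
pose B := k * M + c + 1.
have kM0 : 0 <= k * M + c by rewrite addr_ge0// mulr_ge0.
have B0 : 0 < B by rewrite /B ltr_wpDl.
(* the tail bound for the letter at position j is then at most e / 2 ^ (j + 1) *)
pose L j := B * (2 ^ j.+1)%:R / e.
have L0 j : 0 < L j by rewrite divr_gt0// mulr_gt0// ltr0n expn_gt0.
have [N NL] := choice (fun j => small_weights (L j)).
exists [set w : EA A | forall j, (letter w j <= N j)%N]; split.
- exact: compact_bounded_letters.
- exact: closed_bounded_letters.
near=> n.
have Dn : D n by near: n.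
have IMn : (I (mu n) <= M%:E)%E by near: n.
pose S j : set E := [set w : EA A | (N j < letter w j)%N].
have mS j : measurable (S j).
  by apply: sub_sigma_algebra; case: (@letter_clopen A j [set x | (N j < x)%N]).
rewrite (_ : ~` _ = \bigcup_j S j); last first.
  apply/seteqP; split=> w.
    by move=> /existsNP[j /negP]; rewrite -ltnNge => wj; exists j.
  by move=> [j _ wj] /(_ j); rewrite leqNgt wj.
apply: (le_trans (generalized_Boole_inequality (mu n) mS _)).
  exact: bigcup_measurable.
apply: (@le_trans _ _ (\sum_(0 <= j <oo) (0 + (e / (2 ^ j.+1)%:R)%:E))%E).
  apply: lee_nneseries => // j _; rewrite add0e.
  apply: (le_trans (gibbs_letter_tail (muinv Dn) IMn (L0 j) (NL j) j)).
  rewrite lee_fin /L invf_div mulrA ler_pdivrMr ?mulr_gt0 ?ltr0n ?expn_gt0//.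
  rewrite [X in _ <= X](_ : _ = e * B); last first.
    by rewrite [B * _]mulrC mulrA divfK// pnatr_eq0 -lt0n expn_gt0.
  by rewrite mulrC ler_wpM2l ?(ltW e0)// /B lerDl.
apply: (le_trans (epsilon_trick xpredT (fun=> lexx 0%E) (ltW e0))).
by rewrite eseries0// add0e.
Unshelve. all: by end_near. Qed.

(** The ultrafilter refines the tail filter of the indices in [D], so limits along it
    are cluster points of the sequence indexed by [D]. *)
Theorem zero_temperature_limit : exists nu : probability E R,
  [/\ cluster ((mu n : weakstar A) @[n --> within D \oo]) (nu : weakstar A),
      shift_invariant nu &
      forall nu', shift_invariant nu' -> (I nu <= I nu')%E].
Proof.
have WF : ProperFilter (within D \oo).
  apply: Build_ProperFilter_ex => P PD.
  have PD' : \forall n \near \oo, D n -> P n by exact: PD.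
  have [n [Pn Dn]] := filter_ex (filterI PD' Dnear).
  by exists n; exact: Pn.
have [U [UU DU]] := ultraFilterLemma WF.
have UF : ProperFilter U by exact: ultra_proper.
have Uoo P : \oo P -> U P by move=> PP; apply: DU; apply: filterS PP => n Pn _.
have UD : U D by exact: Uoo.
have tightU e : 0 < e -> exists K : set (EA A),
    [/\ compact K, closed K & \forall n \near U, (mu n (~` K) <= e%:E)%E].
  by move=> /gibbs_tight[K [? ? ?]]; exists K; split => //; exact: Uoo.
have [nu [nuclopen nubounded nulsc]] := @prokhorov_ultrafilter R (EA A) _
  (@word_cylinder_clopen A) (@word_cylinder_base A) mu U UU tightU.
have nuinv : shift_invariant nu.
  move=> B mB.
  have mEA : @measurable _ E = <<s @clopen (EA A) >>.
    apply/seteqP; split.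
      exact: (open_sigma_clopen (@word_cylinder_clopen A) (@word_cylinder_base A)).
    apply: smallest_sub; first exact: smallest_sigma_algebra.
    by move=> C [oC _]; exact: sub_sigma_algebra.
  pose nuE : probability E R := nu.
  have -> : nu (sigma @^-1` B) = pushforward nuE (sigma : E -> E) B by [].
  apply: (@measure_unique _ R E (@clopen (EA A)) (fun=> setT) mEA _ _ _
    (pushforward nuE (sigma : E -> E)) nuE) => //.
  - by move=> P Q; exact: clopenI.
  - by move=> _; exact: clopenT.
  - by rewrite bigcup_const.
  - exact: measurable_shift.
  - move=> ms C cC; rewrite /= /pushforward.
    have cS : clopen (sigma @^-1` C).
      by apply: preimage_clopen => //; exact: shift_continuous.
    have mC (C' : set (EA A)) : clopen C' -> measurable (C' : set E).
      by case=> ? _; exact: sub_sigma_algebra.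
    rewrite -(@fineK _ (nu C)) -1?(@fineK _ (nu (sigma @^-1` C)))
      ?fin_num_measure//; try exact: mC.
    congr EFin; apply: (cvg_unique (@Rhausdorff R) (nuclopen _ cS)).
    apply: cvg_trans (nuclopen _ cC); apply: near_eq_cvg.
    by apply: filterS UD => n Dn; congr fine; rewrite (muinv Dn)//; exact: mC.
  - by move=> ms _; rewrite /= /pushforward preimage_setT probability_setT ltry.
exists nu; split => //.
- move=> P V PP nV.
  have cvgU : (functional (mu n) : prod_topology (fun _ : Cb A => R)) @[n --> U] -->
      functional nu.
    apply/cvg_sup => g W [W' [[Q oQ <-] Qg WW]].
    have := nubounded (sval g) (proj1 (svalP g)) (proj2 (svalP g)).
    have nQ : nbhs (\int[nu]_x sval g x) Q by apply: open_nbhs_nbhs; split => //; exact: Qg.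
    move=> /(_ Q nQ) UQ; change (U [set n | W (functional (mu n))]).
    have {}UQ : U [set n | Q (\int[mu n]_x sval g x)] by exact: UQ.
    by apply: filterS UQ => n Qn; apply: WW.
  have UV : U [set n | V (mu n : weakstar A)].
    move: nV; rewrite nbhsE => -[_ [[Q oQ <-] Qnu] QV].
    have : U [set n | Q (functional (mu n))] by apply: cvgU; apply: open_nbhs_nbhs; split.
    by apply: filterS => n Qn; exact: QV.
  have [n [Pn Vn]] := filter_ex (filterI (DU _ PP) UV).
  by exists (mu n).
- move=> nu' inv'.
  have [fin'|] := boolP (I nu' \is a fin_num); last first.
    by rewrite ge0_fin_numE ?I0// -leNgt leye_eq => /eqP ->; rewrite leey.
  apply/lee_addgt0Pr => e e0.
  rewrite -(fineK fin') -EFinD; apply: nulsc => //.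
  by apply: Uoo; rewrite EFinD fineK//; exact: gibbs_integral_limsup.
Qed.

End zero_temperature.

(** * The Euclidean norm and images of balls under conformal maps *)

Section euclidean_norm.
Context {R : realType} {d : nat}.
Implicit Types (u v w : 'rV[R]_d).

Let sumsq v : R := \sum_i v 0 i ^+ 2.

Let sumsq_ge0 v : 0 <= sumsq v.
Proof. by apply: sumr_ge0 => i _; exact: sqr_ge0. Qed.

Lemma enorm_ge0 v : 0 <= enorm v. Proof. exact: sqrtr_ge0. Qed.

Lemma sqr_enorm v : enorm v ^+ 2 = \sum_i v 0 i ^+ 2.
Proof. by rewrite sqr_sqrtr// sumsq_ge0. Qed.

Lemma coord_le_enorm v i : `|v 0 i| <= enorm v.
Proof.
rewrite -sqrtr_sqr ler_sqrt ?sumsq_ge0// (bigD1 i)//= lerDl.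
by apply: sumr_ge0 => j _; exact: sqr_ge0.
Qed.

Lemma enorm_eq0 v : enorm v = 0 -> v = 0.
Proof.
move=> v0; apply/rowP => i; rewrite mxE; apply/eqP; rewrite -normr_le0 -v0.
exact: coord_le_enorm.
Qed.

Lemma enorm0 : enorm (0 : 'rV[R]_d) = 0.
Proof. by rewrite /enorm big1 ?sqrtr0// => i _; rewrite mxE expr0n. Qed.

Lemma enormZ a v : enorm (a *: v) = `|a| * enorm v.
Proof.
rewrite /enorm -sqrtr_sqr -sqrtrM ?sqr_ge0//; congr Num.sqrt.
by rewrite mulr_sumr; apply: eq_bigr => i _; rewrite mxE exprMn.
Qed.

Lemma enormN v : enorm (- v) = enorm v.
Proof. by rewrite -scaleN1r enormZ normrN1 mul1r. Qed.

Lemma enormB u v : enorm (u - v) = enorm (v - u).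
Proof. by rewrite -enormN opprB. Qed.

Lemma cauchy_schwarz_enorm u v : \sum_i u 0 i * v 0 i <= enorm u * enorm v.
Proof.
have [u0|u0] := eqVneq (enorm u) 0.
  by rewrite u0 mul0r (enorm_eq0 u0) big1// => i _; rewrite mxE mul0r.
have [v0|v0] := eqVneq (enorm v) 0.
  by rewrite v0 mulr0 (enorm_eq0 v0) big1// => i _; rewrite mxE mulr0.
have uv0 : 0 < enorm u * enorm v by rewrite mulr_gt0// lt0r ?u0 ?v0 enorm_ge0.
have : 0 <= \sum_i (enorm v * u 0 i - enorm u * v 0 i) ^+ 2.
  by apply: sumr_ge0 => i _; exact: sqr_ge0.
have -> : \sum_i (enorm v * u 0 i - enorm u * v 0 i) ^+ 2 =
    enorm v ^+ 2 * (\sum_i u 0 i ^+ 2) + enorm u ^+ 2 * (\sum_i v 0 i ^+ 2)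
    - 2 * (enorm u * enorm v) * \sum_i u 0 i * v 0 i.
  rewrite !mulr_sumr -big_split -sumrB /=; apply: eq_bigr => i _; ring.
rewrite -!sqr_enorm => h.
rewrite -(ler_pM2l uv0); nra.
Qed.

Lemma ler_enormD u v : enorm (u + v) <= enorm u + enorm v.
Proof.
rewrite -(@ler_pXn2r _ 2)// ?nnegrE ?addr_ge0 ?enorm_ge0//.
rewrite sqr_enorm sqrrD !sqr_enorm.
have -> : \sum_i (u + v) 0 i ^+ 2 =
    \sum_i u 0 i ^+ 2 + (\sum_i u 0 i * v 0 i) *+ 2 + \sum_i v 0 i ^+ 2.
  by rewrite -sumrMnl -!big_split /=; apply: eq_bigr => i _; rewrite mxE sqrrD.
by rewrite lerD2r lerD2l lerMn2r cauchy_schwarz_enorm.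
Qed.

Lemma coord_le_norm v i : `|v 0 i| <= `|v|.
Proof.
have -> : `|v| = mx_norm v by [].
by rewrite mx_normrE; exact: (le_bigmax _ (fun ij : 'I_1 * 'I_d => `|v ij.1 ij.2|) (0, i)).
Qed.

Lemma norm_le_coord v r : 0 <= r -> (forall i, `|v 0 i| <= r) -> `|v| <= r.
Proof.
move=> r0 vr; have -> : `|v| = mx_norm v by [].
by rewrite mx_normrE; apply/bigmax_leP; split => // -[j i] _ /=; rewrite (ord1 j).
Qed.

Lemma ler_norm_enorm v : `|v| <= enorm v.
Proof. by apply: norm_le_coord => [|i]; [exact: enorm_ge0|exact: coord_le_enorm]. Qed.

Lemma ler_enorm_norm v : enorm v <= Num.sqrt d%:R * `|v|.
Proof.
rewrite -[X in _ * X]normr_id -sqrtr_sqr -sqrtrM// ler_sqrt ?mulr_ge0 ?sqr_ge0//.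
rewrite mulr_natl -[X in _ *+ X]card_ord -sumr_const; apply: ler_sum => i _.
rewrite -[X in X <= _]real_normK ?num_real//; apply: lerXn2r; rewrite ?nnegrE//.
exact: coord_le_norm.
Qed.

Lemma enorm_dist_continuous w : continuous (fun u => enorm (u - w)).
Proof.
move=> v; apply: (proj2 (@cvgrPdist_le _ _ _ _ (@nbhs_filter _ v) _ _)) => e e0.
have K0 : 0 < Num.sqrt d%:R + 1 :> R by rewrite ltr_wpDl// sqrtr_ge0.
apply: (proj2 (@nbhs_normP R 'rV[R]_d v _)).
exists (e / (Num.sqrt d%:R + 1)); first exact: divr_gt0.
move=> u /= /ltW uv.
have : enorm (v - u) <= e.
  apply: (le_trans (ler_enorm_norm _)).
  apply: (@le_trans _ _ ((Num.sqrt d%:R + 1) * `|v - u|)).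
    by rewrite ler_wpM2r// lerDl.
  by rewrite mulrC -ler_pdivlMr.
have := ler_enormD (v - u) (u - w); have := ler_enormD (u - v) (v - w).
rewrite !addrA !subrK [enorm (u - v)]enormB => h1 h2 h3.
by rewrite ler_norml; apply/andP; split; lra.
Qed.

Lemma compact_euclidean_ball v r : compact [set u | enorm (u - v) <= r].
Proof.
apply: bounded_closed_compact.
  exists (`|v| + r); split; first exact: num_real.
  move=> M vM u /= ur; apply: (le_trans _ (ltW vM)).
  rewrite -[u in leLHS](subrK v) addrC; apply: (le_trans (ler_normD _ _)).
  by rewrite lerD2l (le_trans (ler_norm_enorm _)).
apply: (@closed_comp _ _ (fun u => enorm (u - v)) [set x | x <= r]) => [u _|].
  exact: enorm_dist_continuous.
exact: closed_le.
Qed.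

(** The first-order expansion of [f] along a line, in Euclidean norm and at a single
    step [h] as small as desired. *)
Lemma directional_derivative (f : 'rV[R]_d -> 'rV[R]_d) z u e eta :
  differentiable f z -> 0 < e -> 0 < eta ->
  exists2 h, 0 < h < eta & enorm (f (z + h *: u) - f z - h *: 'd f z u) <= e * h.
Proof.
move=> df e0 eta0.
have cvgd : h^-1 *: ((f \o shift z) (h *: u) - f z) @[h --> 0^'] --> 'd f z u.
  by rewrite -(deriveE u df); exact: diff_derivable.
have K0 : 0 < Num.sqrt d%:R + 1 :> R by rewrite ltr_wpDl// sqrtr_ge0.
have : \forall h \near (0 : R), h != 0 ->
    `|'d f z u - h^-1 *: ((f \o shift z) (h *: u) - f z)| <= e / (Num.sqrt d%:R + 1).
  exact: (cvgr_dist_le _ _ cvgd _ (divr_gt0 e0 K0)).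
move=> /(proj1 (nbhs_normP (0 : R) _))[r /= r0 hr].
have mn0 : 0 < Num.min r eta by rewrite lt_min r0 eta0.
have mnr : Num.min r eta <= r by rewrite ge_min lexx.
have mne : Num.min r eta <= eta by rewrite ge_min lexx orbT.
pose h := Num.min r eta / 2.
have h0 : 0 < h by rewrite divr_gt0.
have hr' : h < r by rewrite /h; lra.
have he : h < eta by rewrite /h; lra.
exists h; first by rewrite h0 he.
have := hr h; rewrite /= sub0r normrN gtr0_norm// => /(_ hr' (lt0r_neq0 h0)).
set D := 'd f z u - _ => De.
have -> : f (z + h *: u) - f z - h *: 'd f z u = - h *: D.
  rewrite /D scalerBr scalerA mulNr divff ?gt_eqF// scaleNr scaleN1r opprK addrC.
  by rewrite [h *: u + z]addrC.
rewrite enormZ normrN gtr0_norm// mulrC ler_wpM2r ?(ltW h0)//.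
apply: (le_trans (ler_enorm_norm _)).
apply: (@le_trans _ _ ((Num.sqrt d%:R + 1) * `|D|)).
  by rewrite ler_wpM2r// lerDl.
by rewrite mulrC -ler_pdivlMr.
Qed.

Lemma conformal_surjective (L : {linear 'rV[R]_d -> 'rV[R]_d}) (a : R) :
  0 < a -> (forall v, enorm (L v) = a * enorm v) -> forall w, exists u, L u = w.
Proof.
move=> a0 La w.
have freeL : row_free (lin1_mx L).
  apply: inj_row_free => v; rewrite mul_rV_lin1 => Lv.
  have := La v; rewrite Lv enorm0 => /esym/eqP; rewrite mulf_eq0 gt_eqF//=.
  by move=> /eqP/enorm_eq0.
have uL : lin1_mx L \in unitmx by rewrite -row_free_unit.
by exists (w *m invmx (lin1_mx L)); rewrite -mul_rV_lin1 mulmxKV.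
Qed.

(** The image of a ball under a map that expands at least by [m] infinitesimally
    contains a ball of radius [m / 2 * delta]. Rather than lifting the segment from
    [f x0] to [y], minimize the distance from [f z] to [y] with the penalty
    [m / 2 * |z - x0|] over the ball. By comparison with [x0] a minimizer is interior,
    and if its image is not [y], a short step in the direction that ['d f z] maps to
    [y - f z] lowers the distance at least twice as fast as it raises the penalty. *)
Lemma conformal_image_ball (f : 'rV[R]_d -> 'rV[R]_d) x0 delta m y :
  0 < delta -> 0 < m ->
  (forall z, enorm (z - x0) <= delta -> differentiable f z /\
     m <= scaling f z /\ forall v, enorm ('d f z v) = scaling f z * enorm v) ->
  enorm (y - f x0) < m / 2 * delta ->
  exists2 z, enorm (z - x0) <= delta & f z = y.
Proof.
move=> d0 m0 fB yf.
pose Psi z := enorm (f z - y) + m / 2 * enorm (z - x0).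
pose B := [set z | enorm (z - x0) <= delta].
have Bx0 : B x0 by rewrite /B /= subrr enorm0 ltW.
have cPsi : {within B, continuous Psi}.
  apply: continuous_in_subspaceT => z /set_mem Bz.
  have [dfz _] := fB z Bz.
  have c1 : continuous_at z ((fun v => enorm (v - y)) \o f).
    apply: continuous_comp; first exact: differentiable_continuous.
    exact: enorm_dist_continuous.
  apply: (@cvgD _ _ _ _ (nbhs_filter z) _ _ _ _ c1).
  apply: (@cvgM _ _ _ (nbhs_filter z)); first exact: cvg_cst.
  exact: enorm_dist_continuous.
have [z /set_mem Bz zmin] := @compact_EVT_min _ R Psi B (ex_intro _ x0 Bx0)
  (@compact_euclidean_ball x0 delta) cPsi.
exists z => //; apply/eqP; rewrite -subr_eq0; apply/negPn/negP => fzy.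
have w0 : 0 < enorm (y - f z).
  rewrite lt0r enorm_ge0 andbT; apply/negP => /eqP/enorm_eq0 yz.
  by move: fzy; rewrite -opprB yz oppr0 eqxx.
have zx0 : enorm (z - x0) < delta.
  have := zmin x0 (mem_set Bx0); rewrite /Psi subrr enorm0 mulr0 addr0.
  rewrite [enorm (f x0 - y)]enormB => h.
  have m20 : 0 < m / 2 by rewrite divr_gt0.
  rewrite -(ltr_pM2l m20); apply: le_lt_trans yf; apply: le_trans h.
  by rewrite lerDr enorm_ge0.
have [dfz [mz confz]] := fB z Bz.
have [u uw] := conformal_surjective (lt_le_trans m0 mz) confz (y - f z).
have uW : m * enorm u <= enorm (y - f z).
  by rewrite -uw confz ler_wpM2r// enorm_ge0.
have u0 : 0 <= enorm u := enorm_ge0 u.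
(* steps shorter than eta stay in the ball *)
pose eta := Num.min 1 ((delta - enorm (z - x0)) / (enorm u + 1)).
have eta0 : 0 < eta.
  by rewrite lt_min ltr01 divr_gt0 ?subr_gt0// ltr_wpDl.
have e0 : 0 < enorm (y - f z) / 4 by rewrite divr_gt0.
have [h /andP[h0 heta]] := directional_derivative u dfz e0 eta0.
have eu0 : 0 < enorm u + 1 by rewrite ltr_wpDl.
move: heta; rewrite lt_min (ltr_pdivlMr _ _ eu0) => /andP[h1 hd].
rewrite uw => hf.
pose z1 := z + h *: u.
have z1z : enorm (z1 - x0) <= enorm (z - x0) + h * enorm u.
  rewrite /z1 addrAC; apply: (le_trans (ler_enormD _ _)).
  by rewrite enormZ (gtr0_norm h0).
have Bz1 : B z1.
  by rewrite /B /=; apply: (le_trans z1z); nra.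
have := zmin z1 (mem_set Bz1); rewrite /Psi.
have : enorm (f z1 - y) <= (1 - h) * enorm (y - f z) + enorm (y - f z) / 4 * h.
  have -> : f z1 - y = - (1 - h) *: (y - f z) + (f z1 - f z - h *: (y - f z)).
    rewrite scaleNr scalerBl scale1r opprB; apply/rowP => i; rewrite !mxE; ring.
  apply: (le_trans (ler_enormD _ _)); apply: lerD => //.
  by rewrite enormZ normrN ger0_norm ?subr_ge0 ?(ltW h1).
rewrite [enorm (f z - y)]enormB.
have : m / 2 * enorm (z1 - x0) <= m / 2 * enorm (z - x0) + h * enorm (y - f z) / 2.
  have m20 : 0 <= m / 2 by rewrite divr_ge0// ltW.
  apply: (le_trans (ler_wpM2l m20 z1z)); rewrite mulrDr lerD2l.
  have := ler_wpM2l (ltW h0) uW; nra.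
have := mulr_gt0 h0 w0; nra.
Qed.

End euclidean_norm.

(** * Summability of the contraction ratios *)

Section counting.
Context {R : realType}.

(** The partial sums telescope: [1 / (n + 1) ^ 2 <= 1 / n - 1 / (n + 1)]. The term
    [j = 0] is 0 by the convention for the inverse of 0. *)
Lemma sum_inv_sqr_le2 n : \sum_(j < n) (j%:R : R) ^- 2 <= 2.
Proof.
suff h : \sum_(j < n.+2) (j%:R : R) ^- 2 <= 2 - (n.+1%:R)^-1.
  apply: (@le_trans _ _ (2 - n.+1%:R^-1)); last by rewrite lerBlDr lerDl invr_ge0.
  apply: le_trans h; rewrite 2!big_ord_recr /= -addrA lerDl.
  by rewrite addr_ge0// invr_ge0 exprn_ge0.
elim: n => [|n IH].
  by rewrite 2!big_ord_recl big_ord0 /= expr0n invr0 add0r addr0 expr1n invr1; lra.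
rewrite big_ord_recr /=; apply: (le_trans (lerD IH (lexx _))).
set x : R := n.+1%:R; have x0 : 0 < x by rewrite ltr0n.
have -> : n.+2%:R = x + 1 :> R by rewrite natr1.
have x10 : 0 < x + 1 by lra.
rewrite -subr_ge0.
have -> : 2 - (x + 1)^-1 - (2 - x^-1 + (x + 1) ^- 2) = (x * (x + 1) ^+ 2)^-1.
  by field; rewrite !gt_eqF.
by rewrite invr_ge0 mulr_ge0 ?exprn_ge0 ?ltW.
Qed.

(** Grouping the indices by the value [N] of [a], each group contributes at most
    [B * N ^- 2]. *)
Lemma sum_inv_pow_le (a : nat -> nat) (B : R) (d n : nat) :
  (forall e, (0 < a e)%N) -> 0 <= B ->
  (forall N, (0 < N)%N -> (#|[pred e : 'I_n | a e == N]|%:R : R) <= B * N%:R ^+ d) ->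
  \sum_(e < n) ((a e)%:R : R) ^- (d + 2) <= 2 * B.
Proof.
move=> a0 B0 aB.
pose m := (\max_(e < n) a e).+1.
have am (e : 'I_n) : (a e < m)%N.
  by rewrite ltnS; exact: (@leq_bigmax _ (fun e : 'I_n => a e)).
have -> : \sum_(e < n) ((a e)%:R : R) ^- (d + 2) =
    \sum_(j < m) #|[pred e : 'I_n | a e == j]|%:R * (j%:R : R) ^- (d + 2).
  rewrite (partition_big (fun e : 'I_n => Ordinal (am e)) xpredT) //=.
  apply: eq_bigr => j _; rewrite -sum1_card natr_sum mulr_suml.
  rewrite (eq_bigl (fun e : 'I_n => a e == j)); last by move=> e; rewrite -val_eqE.
  rewrite [RHS](eq_bigl (fun e : 'I_n => a e == j)); last by move=> e; rewrite inE.
  by apply: eq_bigr => e /eqP ->; rewrite mul1r.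
apply: (@le_trans _ _ (\sum_(j < m) B * (j%:R : R) ^- 2)); last first.
  by rewrite -mulr_sumr mulrC ler_wpM2r// sum_inv_sqr_le2.
apply: ler_sum => j _; case: (posnP j) => [j0|j0].
  rewrite j0 (_ : #|_| = 0%N) ?mul0r; first by rewrite mulr_ge0// invr_ge0 exprn_ge0.
  by apply: eq_card0 => e; rewrite !inE; apply/negbTE; rewrite -lt0n.
have jd : 0 < (j%:R : R) ^+ d by rewrite exprn_gt0// ltr0n.
apply: (@le_trans _ _ (B * j%:R ^+ d * (j%:R : R) ^- (d + 2))).
  by rewrite ler_wpM2r ?aB// invr_ge0 exprn_ge0.
by rewrite exprD invfM -mulrA [X in _ * X]mulrA divff ?gt_eqF// mul1r.
Qed.

Lemma fin_upper_bound (I : finType) (g : I -> R) : exists2 M, 0 < M & forall i, g i <= M.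
Proof.
exists (\sum_i `|g i| + 1); first by rewrite ltr_wpDl// sumr_ge0.
move=> i; rewrite (bigD1 i)//= -addrA; apply: (le_trans (ler_norm _)).
by rewrite lerDl addr_ge0// sumr_ge0.
Qed.

End counting.

Section geometry.
Context {R : realType} {d : nat} (Phi : CGDMS R d).
Notation ter := (ter Phi).
Notation ini := (ini Phi).
Notation X := (@Xset R d Phi).
Notation W := (@Wset R d Phi).
Notation phi := (phi Phi).

Lemma Xset_subW v : X v `<=` W v. Proof. by have [] := Wset_spec v. Qed.

Lemma Xset_inner_ball : exists2 delta : R, 0 < delta & exists x : vertex Phi -> 'rV[R]_d,
  forall v z, enorm (z - x v) <= delta -> interior (X v) z.
Proof.
have ball v : exists xr : 'rV[R]_d * R, 0 < xr.2 /\
    forall z, enorm (z - xr.1) <= xr.2^-1 -> interior (X v) z.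
  have [x ix] : interior (X v) !=set0.
    apply/set0P/negP => /eqP i0; have [x] := Xset_neq0 v.
    by rewrite Xset_regular i0 closure0.
  have := open_nbhs_nbhs (conj (@open_interior _ (X v)) ix).
  move=> /(proj1 (@nbhs_normP R 'rV[R]_d x _))[r /= r0 rX].
  exists (x, 2 / r); split; first by rewrite divr_gt0.
  move=> z /=; rewrite invf_div => zx; apply: rX => /=.
  rewrite distrC; apply: (le_lt_trans (ler_norm_enorm _)); apply: (le_lt_trans zx).
  by rewrite ltr_pdivrMr// ltr_pMr// ltr1n.
have [xr xrP] := choice ball.
have [M M0 xrM] := fin_upper_bound (fun v => (xr v).2).
exists M^-1; first by rewrite invr_gt0.
exists (fun v => (xr v).1) => v z zx; have [r0 ] := xrP v; apply.
by apply: (le_trans zx); rewrite lef_pV2 ?posrE.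
Qed.

Lemma Wset_bound : exists2 M : R, 0 < M & forall v z, W v z -> `|z| <= M.
Proof.
have bnd v : exists M : R, forall z, W v z -> `|z| <= M.
  have [_ _ [M [_ MW]] _] := Wset_spec v.
  by exists (M + 1) => z Wz; apply: MW => //; rewrite ltrDl.
have [M_ M_P] := choice bnd.
have [M M0 MP] := fin_upper_bound M_.
by exists M => // v z Wz; apply: le_trans (MP v); exact: M_P.
Qed.

(** The Hoelder estimate on [|phi_e'|] becomes a bound on ratios because the
    neighborhoods [W] are bounded. *)
Lemma distortion : exists2 K : R, 1 <= K & forall e x y,
  W (ter e) x -> W (ter e) y -> dphi Phi e y <= K * dphi Phi e x.
Proof.
have [L [kappa [L1 k0 Lk]]] := phi_distortion Phi.
have [M M0 WM] := Wset_bound.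
pose D := (Num.sqrt d%:R * (M + M)) `^ kappa.
exists (1 + L * D); first by rewrite lerDl mulr_ge0 ?powR_ge0// (le_trans ler01).
move=> e x y Wx Wy; have [sx _] := phi_conformal Wx.
have : dphi Phi e y - dphi Phi e x <= L * dphi Phi e x * D.
  apply: (le_trans (ler_norm _)); apply: (le_trans (Lk e x y Wx Wy)).
  rewrite ler_wpM2l//; first by rewrite mulr_ge0 ?(ltW sx)// (le_trans ler01).
  apply: ge0_ler_powR; rewrite ?nnegrE ?enorm_ge0 ?(ltW k0)//.
    by rewrite mulr_ge0 ?sqrtr_ge0// addr_ge0// ltW.
  apply: (le_trans (ler_enorm_norm _)); rewrite ler_wpM2l ?sqrtr_ge0//.
  apply: (le_trans (ler_normB _ _)); apply: lerD; [exact: (WM _ _ Wy)|exact: (WM _ _ Wx)].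
by rewrite mulrDl mul1r -lerBlDl mulrAC.
Qed.

Lemma dphi_gt0 e x : W (ter e) x -> 0 < dphi Phi e x.
Proof. by move=> Wx; have [] := phi_conformal Wx. Qed.

(** In dimension 0 the supremum over unit vectors is that of the empty set, namely 0,
    which contradicts the positivity of the scaling factor. *)
Lemma exists_unit_vector : exists v : 'rV[R]_d, enorm v = 1.
Proof.
have [x Xx] := Xset_neq0 (ter 0%N).
have := dphi_gt0 (Xset_subW Xx); rewrite /dphi /scaling.
set S := (X in sup X); have [->|/set0P[_ [v v1 _]] _] := eqVneq S set0.
  by rewrite sup0 ltxx.
by exists v.
Qed.

Lemma dphi_le1 e x : W (ter e) x -> dphi Phi e x <= 1.
Proof.
move=> Wx; have [s s1 sc] := phi_contracting Phi.
have [v v1] := exists_unit_vector.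
have [_ confx] := phi_conformal Wx.
have [oW _ C1 _] := phi_diffeo Phi e.
have [dfx _] := C1 x Wx.
have -> : dphi Phi e x = enorm ('d (phi e) x v) by rewrite confx v1 mulr1.
apply/ler_addgt0Pr => eps eps0.
have := open_nbhs_nbhs (conj oW Wx).
move=> /(proj1 (@nbhs_normP R 'rV[R]_d x _))[r /= r0 rW].
have [h /andP[h0 hr] dh] := directional_derivative v dfx eps0 r0.
have Wxh : W (ter e) (x + h *: v).
  apply: rW => /=; rewrite opprD addrA subrr sub0r normrN.
  by apply: (le_lt_trans (ler_norm_enorm _)); rewrite enormZ v1 mulr1 gtr0_norm.
have := sc e _ _ Wxh Wx; rewrite addrAC subrr add0r enormZ v1 mulr1 gtr0_norm// => le1.
have le2 : h * enorm ('d (phi e) x v) <= s * h + eps * h.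
  rewrite -[h in leLHS]gtr0_norm// -enormZ.
  have -> : h *: 'd (phi e) x v = (phi e (x + h *: v) - phi e x) -
     (phi e (x + h *: v) - phi e x - h *: 'd (phi e) x v) by rewrite opprB addrC subrK.
  by apply: (le_trans (ler_enormD _ _)); rewrite enormN lerD.
have sh : s * h <= h by rewrite ger_pMl// ltW.
by rewrite -(ler_pM2l h0) mulrDr mulr1; lra.
Qed.

Definition dphi_sup e : R := supnorm (X (ter e)) (dphi Phi e).

Let supE e : has_sup [set `|dphi Phi e x| | x in X (ter e)].
Proof.
split.
  by have [x Xx] := Xset_neq0 (ter e); exists `|dphi Phi e x|, x.
exists 1 => _ [x /Xset_subW Wx <-]; rewrite gtr0_norm; [exact: dphi_le1|exact: dphi_gt0].
Qed.

Lemma dphi_le_sup e x : X (ter e) x -> dphi Phi e x <= dphi_sup e.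
Proof.
move=> Xx; apply: (le_trans (ler_norm _)).
by apply: (sup_upper_bound (supE e)); exists x.
Qed.

Lemma dphi_sup_le e r : (forall x, X (ter e) x -> dphi Phi e x <= r) -> dphi_sup e <= r.
Proof.
move=> xr; apply: ge_sup; first by case: (supE e).
by move=> _ [x Xx <-]; rewrite gtr0_norm; [exact: xr|exact/dphi_gt0/Xset_subW].
Qed.

Lemma dphi_sup_le1 e : dphi_sup e <= 1.
Proof. by apply: dphi_sup_le => x /Xset_subW; exact: dphi_le1. Qed.

Lemma dphi_sup_gt0 e : 0 < dphi_sup e.
Proof.
have [x Xx] := Xset_neq0 (ter e).
exact: lt_le_trans (dphi_gt0 (Xset_subW Xx)) (dphi_le_sup Xx).
Qed.

(** Apply [conformal_image_ball] to a ball inside [X]: by distortion [|phi_e'|] is at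
    least [dphi_sup e / K] on it. A cube of half-side [r] lies in the Euclidean ball of
    radius [sqrt d * r], whence the factor [sqrt d + 1], which makes this strict. *)
Lemma image_contains_box : exists2 c : R, 0 < c & exists y : nat -> 'rV[R]_d,
  forall e, X (ini e) (y e) /\
    forall z, `|z - y e| <= c * dphi_sup e -> (phi e @` interior (X (ter e))) z.
Proof.
have [delta d0 [x xP]] := Xset_inner_ball.
have [K K1 Kd] := distortion.
have K0 : 0 < K by exact: lt_le_trans K1.
have s0 : 0 < Num.sqrt d%:R + 1 :> R by rewrite ltr_wpDl// sqrtr_ge0.
exists (delta / (2 * K * (Num.sqrt d%:R + 1))); first by rewrite divr_gt0// !mulr_gt0.
exists (fun e => phi e (x (ter e))) => e.
have intX z : enorm (z - x (ter e)) <= delta -> X (ter e) z.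
  by move=> /xP; exact: interior_subset.
have Xx : X (ter e) (x (ter e)) by apply: intX; rewrite subrr enorm0 ltW.
split; first by apply: phi_maps; exists (x (ter e)).
move=> z zy.
have m0 : 0 < dphi_sup e / K by rewrite divr_gt0// dphi_sup_gt0.
have confB u : enorm (u - x (ter e)) <= delta -> differentiable (phi e) u /\
    dphi_sup e / K <= scaling (phi e) u /\
    forall v, enorm ('d (phi e) u v) = scaling (phi e) u * enorm v.
  move=> /intX/Xset_subW Wu; have [_ _ C1 _] := phi_diffeo Phi e.
  have [_ confu] := phi_conformal Wu.
  split; first by have [] := C1 u Wu.
  split => //; rewrite ler_pdivrMr// mulrC; apply: dphi_sup_le => y Xy.
  by apply: Kd => //; exact: Xset_subW.
have zr : enorm (z - phi e (x (ter e))) < dphi_sup e / K / 2 * delta.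
  apply: (le_lt_trans (ler_enorm_norm _)).
  apply: (@le_lt_trans _ _
      (Num.sqrt d%:R * (delta / (2 * K * (Num.sqrt d%:R + 1)) * dphi_sup e))).
    by rewrite ler_wpM2l ?sqrtr_ge0.
  have -> : dphi_sup e / K / 2 * delta =
      (Num.sqrt d%:R + 1) * (delta / (2 * K * (Num.sqrt d%:R + 1)) * dphi_sup e).
    by field; rewrite !gt_eqF.
  have cpos : 0 < delta / (2 * K * (Num.sqrt d%:R + 1)) * dphi_sup e.
    by rewrite mulr_gt0 ?dphi_sup_gt0// divr_gt0// !mulr_gt0.
  by rewrite (ltr_pM2r cpos) ltrDl.
have [u ud <-] := conformal_image_ball d0 m0 confB zr.
by exists u => //; exact: xP.
Qed.

(** Round each center down to the grid of step [1 / N]. The grid point lies in the cube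
    around the center, hence in the image [phi e (Int X)]; two indices with the same
    grid point in the same copy would contradict the open set condition. *)
Lemma card_scale_le (c : R) (y : nat -> 'rV[R]_d) (n N : nat) (a : nat -> nat) (B : nat) :
  (forall e, X (ini e) (y e) /\
    forall z, `|z - y e| <= c * dphi_sup e -> (phi e @` interior (X (ter e))) z) ->
  (forall v z, X v z -> `|z| <= B%:R) ->
  (forall e, a e = N -> (N%:R)^-1 <= c * dphi_sup e) -> (0 < N)%N ->
  (#|[pred e : 'I_n | a e == N]| <= #|vertex Phi| * (2 * B * N).+1 ^ d)%N.
Proof.
move=> yP XB aN N0.
have N0' : 0 < N%:R :> R by rewrite ltr0n.
have coord_bnd e i : - B%:R <= y e 0 i <= B%:R.
  by rewrite -ler_norml (le_trans (coord_le_norm _ _))//; have [/XB] := yP e.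
pose g (e : nat) (i : 'I_d) := Num.truncn ((y e 0 i + B%:R) * N%:R).
have gT e i : (g e i)%:R <= (y e 0 i + B%:R) * N%:R < (g e i).+1%:R.
  apply: truncn_itv; rewrite mulr_ge0// -lerBlDr sub0r.
  by have /andP[] := coord_bnd e i.
have gB e i : (g e i < (2 * B * N).+1)%N.
  rewrite ltnS -(ler_nat R); have /andP[/le_trans + _] := gT e i; apply.
  rewrite natrM ler_wpM2r// natrM mulrDl mul1r lerD2r.
  by have /andP[] := coord_bnd e i.
pose key (e : 'I_n) : vertex Phi * {ffun 'I_d -> 'I_(2 * B * N).+1} :=
  (ini e, [ffun i => Ordinal (gB e i)]).
have -> : (#|vertex Phi| * (2 * B * N).+1 ^ d)%N =
    #|{: vertex Phi * {ffun 'I_d -> 'I_(2 * B * N).+1}}|.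
  by rewrite card_prod card_ffun !card_ord.
rewrite -(card_in_imset (f := key) (D := [pred e : 'I_n | a e == N])).
  exact: max_card.
move=> e1 e2; rewrite !inE => /eqP ae1 /eqP ae2 [ini12 g12].
apply/eqP/negPn/negP => e12.
pose z := \row_i ((g e1 i)%:R / N%:R - B%:R) : 'rV[R]_d.
have zin (e : 'I_n) : a e = N -> (forall i, g e i = g e1 i) ->
    (phi e @` interior (X (ter e))) z.
  move=> ae ge; have [_] := yP e; apply; apply: le_trans (aN e ae).
  apply: norm_le_coord; first by rewrite invr_ge0.
  move=> i; rewrite !mxE -ge.
  have /andP[lo hi] := gT e i.
  have lo' : (g e i)%:R / N%:R <= y e 0 i + B%:R by rewrite ler_pdivrMr.
  have hi' : y e 0 i + B%:R < (g e i)%:R / N%:R + N%:R^-1.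
    have -> : (g e i)%:R / N%:R + N%:R^-1 = (g e i).+1%:R / N%:R :> R.
      by rewrite -natr1 mulrDl mul1r.
    by rewrite ltr_pdivlMr.
  have N1 : 0 < (N%:R : R)^-1 by rewrite invr_gt0.
  by rewrite ler_norml; apply/andP; split; lra.
have := phi_open_set_condition Phi (a := e1) (b := e2).
move=> /(_ _)/wrap[]; first by move=> /val_inj/eqP; rewrite (negbTE e12).
move=> /seteqP[+ _] => /(_ (ini e1, z)); apply; split.
  by exists z => //; apply: zin.
rewrite ini12; exists z => //; apply: zin => // i.
by have /ffunP/(_ i) := g12; rewrite !ffunE => -[->].
Qed.

(** The exponent [d + 2] beats the growth [N ^ d] of the number of indices at scale
    [1 / N] by a summable factor. *)
Lemma dphi_summable : exists2 Z : R, 0 < Z &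
  forall n, \sum_(e < n) dphi_sup e ^+ (d + 2) <= Z.
Proof.
have [c0 c00 [y yP0]] := image_contains_box.
pose c := Num.min c0 1.
have c01 : 0 < c by rewrite lt_min c00 ltr01.
have c1 : c <= 1 by rewrite ge_min lexx orbT.
have yP e : X (ini e) (y e) /\
    forall z, `|z - y e| <= c * dphi_sup e -> (phi e @` interior (X (ter e))) z.
  have [yX yb] := yP0 e; split => // z zy; apply: yb; apply: (le_trans zy).
  by rewrite ler_wpM2r ?(ltW (dphi_sup_gt0 e))// ge_min lexx.
have [M M0 WM] := Wset_bound.
pose B := (Num.truncn M).+1.
have XB v z : X v z -> `|z| <= B%:R.
  move=> /Xset_subW/WM/le_trans; apply.
  by have /andP[_ /ltW] := truncn_itv (ltW M0).
(* 1 / a e is below the size c * dphi_sup e of the cube, by a factor at most 2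
   since that size is at most 1 *)
pose a e := (Num.truncn (c * dphi_sup e)^-1).+1.
have r0 e : 0 < c * dphi_sup e by rewrite mulr_gt0 ?dphi_sup_gt0.
have r1 e : c * dphi_sup e <= 1.
  apply: mulr_ile1 => //; [exact: ltW|exact/ltW/dphi_sup_gt0|exact: dphi_sup_le1].
have aT e : (c * dphi_sup e)^-1 < (a e)%:R <= (c * dphi_sup e)^-1 + 1.
  have r0' : 0 <= (c * dphi_sup e)^-1 by rewrite invr_ge0 ltW.
  by have /andP[lo hi] := truncn_itv r0'; rewrite hi /a -natr1 lerD2r.
pose A := (#|vertex Phi| * (2 * B + 1) ^ d)%N.
exists (2 * A%:R * (2 / c) ^+ (d + 2) + 1).
  by rewrite ltr_wpDl// mulr_ge0// exprn_ge0// divr_ge0// ltW.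
move=> n.
apply: (@le_trans _ _ (\sum_(e < n) (2 / c) ^+ (d + 2) * ((a e)%:R : R) ^- (d + 2))).
  apply: ler_sum => e _; rewrite -exprVn -exprMn; apply: lerXn2r.
  - by rewrite nnegrE ltW// dphi_sup_gt0.
  - by rewrite nnegrE mulr_ge0// ?invr_ge0// divr_ge0// ltW.
  have a0 : 0 < (a e)%:R :> R by rewrite ltr0n.
  rewrite ler_pdivlMr// mulrC ler_pdivlMr// -mulrA [dphi_sup e * _]mulrC.
  have /andP[_ hi] := aT e.
  apply: (le_trans (ler_wpM2r (ltW (r0 e)) hi)).
  by rewrite mulrDl mulVf ?gt_eqF// mul1r; have := r1 e; lra.
rewrite -mulr_sumr mulrC.
apply: (@le_trans _ _ (2 * A%:R * (2 / c) ^+ (d + 2))); last by rewrite lerDl.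
rewrite ler_wpM2r//; first by rewrite exprn_ge0// divr_ge0// ltW.
apply: sum_inv_pow_le => // N N0.
rewrite -natrX -natrM ler_nat.
have aN e : a e = N -> (N%:R)^-1 <= c * dphi_sup e.
  move=> <-; rewrite -[leRHS]invrK lef_pV2 ?posrE ?invr_gt0 ?ltr0n//.
  by have /andP[/ltW] := aT e.
apply: (leq_trans (card_scale_le n yP XB aN N0)).
rewrite /A -[leqRHS]mulnA; apply: leq_mul => //; rewrite -expnMn.
have le1 : ((2 * B * N).+1 <= (2 * B + 1) * N)%N by rewrite mulnDl mul1n -addn1 leq_add.
by case: (posnP d) => [->//|d0]; rewrite leq_exp2r.
Qed.

End geometry.

(** * The coding map and the amalgamated functions *)

(** The integral of [g] may be infinite, where linearity is not available: then the
    positive part of [g + c] has infinite integral and the negative part is at most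
    [`|c|]. *)
Lemma integral_add_const d (T : measurableType d) (R : realType) (m : probability T R)
    (g : T -> R) (c : R) :
  measurable_fun setT g -> (forall x, 0 <= g x) ->
  (\int[m]_x (g x + c)%:E = \int[m]_x (g x)%:E + c%:E)%E.
Proof.
move=> mg g0.
have I0 : (0 <= \int[m]_x (g x)%:E)%E by apply: integral_ge0 => x _; rewrite lee_fin.
have mgE : measurable_fun setT (fun x => (g x)%:E) by exact/measurable_EFinP.
have [Ifin|] := boolP ((\int[m]_x (g x)%:E)%E \is a fin_num).
  under eq_integral do rewrite EFinD.
  rewrite integralD//; last exact: (finite_measure_integrable_cst m c measurableT).
    rewrite integral_cst// [X in (_ + _ * X)%E](_ : _ = 1%E) ?mule1//.
    exact: probability_setT.
  apply/integrableP; split => //.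
  under eq_integral do rewrite gee0_abs ?lee_fin//.
  by rewrite -ge0_fin_numE.
rewrite ge0_fin_numE// -leNgt leye_eq => /eqP Ioo.
rewrite Ioo addye// integralE.
have mgc : measurable_fun setT (fun x => g x + c) by exact: measurable_funD.
have pos : (\int[m]_x (fun x => (g x + c)%:E)^\+ x = +oo)%E.
  have := @le_integral_add _ _ _ m g (fun x => Num.max (g x + c) 0) `|c| mg.
  move=> /(_ _)/wrap[]; first exact: measurable_funrpos.
  move=> /(_ g0)/(_ _)/wrap[]; first by move=> x; rewrite le_max lexx orbT.
  move=> /(_ _)/wrap[].
    move=> x; apply: (@le_trans _ _ (g x + c + `|c|)); last by rewrite lerD2r le_max lexx.
    by rewrite -addrA lerDl -lerBlDr sub0r lerNl -normrN ler_norm.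
  rewrite Ioo leye_eq.
  have -> : ((fun x => (g x + c)%:E)^\+ = fun x => (Num.max (g x + c) 0)%:E)%E.
    by apply/funext => x; rewrite funeposE EFin_max.
  set J := (\int[m]_x _)%E; case: J => //=.
have neg : (\int[m]_x (fun x => (g x + c)%:E)^\- x <= `|c|%:E)%E.
  apply: (@le_trans _ _ (\int[m]_x (cst `|c|%:E) x)%E).
    apply: ge0_le_integral => //.
    - by apply: measurable_funeneg; exact/measurable_EFinP.
    - move=> x _; rewrite funenegE -EFinN -EFin_max lee_fin ge_max normr_ge0 andbT.
      by rewrite opprD; have := g0 x; have := ler_norm (- c); rewrite normrN; lra.
  by rewrite integral_cst// [X in (_ * X)%E](_ : _ = 1%E) ?mule1//; exact: probability_setT.
have := le_lt_trans neg (ltry `|c|).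
by rewrite pos; case: (\int[m]_x _)%E.
Qed.

Section coding.
Context {R : realType} {d : nat} (Phi : CGDMS R d).
Notation ter := (ter Phi).
Notation ini := (ini Phi).
Notation X := (@Xset R d Phi).
Notation phi := (phi Phi).
Notation A := (inc Phi).
Notation sigma := (@Defs.shift A).

Let piece (u : seq nat) := phi_word Phi u @` X (word_ter Phi u).

Lemma continuous_phi e x : X (ter e) x -> {for x, continuous (phi e)}.
Proof.
move=> /Xset_subW Wx; have [_ _ C1 _] := phi_diffeo Phi e.
by have [dx _] := C1 x Wx; exact: differentiable_continuous.
Qed.

(** The images of prefixes decrease and are compact, by induction on the word from its
    first letter. *)
Lemma piece_compact_sub a u : admissible A (a :: u) ->
  compact (piece (a :: u)) /\ piece (a :: u) `<=` X (ini a).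
Proof.
have cphi e (S : set 'rV[R]_d) : S `<=` X (ter e) -> compact S -> compact (phi e @` S).
  move=> SX cS; apply: continuous_compact => //.
  by apply: continuous_in_subspaceT => x /set_mem/SX; exact: continuous_phi.
elim: u a => [|b u IH] a.
  move=> _; rewrite /piece /word_ter /=; split.
    by apply: cphi => //; exact: Xset_compact.
  exact: phi_maps.
rewrite /admissible /= => /andP[ab bu].
have [cb sb] := IH b bu.
have -> : piece [:: a, b & u] = phi a @` piece (b :: u).
  by rewrite /piece image_comp.
rewrite -(inc_compat (c := Phi) ab) in sb.
split; first exact: cphi.
by move=> _ [x /sb Xx <-]; apply: phi_maps; exists x.
Qed.

Lemma restr_rcons w n : restr w n.+1 = rcons (@restr A w n) (letter w n).
Proof. by rewrite /restr /mkseq -addn1 iotaD map_cat cats1 add0n. Qed.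

Lemma restr_cons w n : restr w n.+1 = letter w 0 :: restr (sigma w) n.
Proof.
rewrite /restr /mkseq /= -[1%N]addn0 iotaDl -map_comp; congr (_ :: _).
Qed.

Lemma piece_anti w n : piece (restr w n.+2) `<=` piece (@restr A w n.+1).
Proof.
rewrite (restr_rcons w n.+1) => _ [x Xx <-].
have -> : phi_word Phi (rcons (restr w n.+1) (letter w n.+1)) x =
    phi_word Phi (restr w n.+1) (phi (letter w n.+1) x).
  by elim: (restr w n.+1) => [//|a u IH] /=; rewrite IH.
exists (phi (letter w n.+1) x) => //.
have -> : word_ter Phi (restr w n.+1) = ini (letter w n.+1).
  rewrite /word_ter restr_rcons last_rcons.
  apply: (inc_compat (c := Phi)); exact: (set_mem (svalP w) n).
apply: phi_maps; exists x => //.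
by move: Xx; rewrite /word_ter last_rcons.
Qed.

(** A cluster point of points chosen in the nested compact pieces lies in all of them,
    so the choice that defines the coding map is made in a nonempty set. *)
Lemma coding_piece (w : EA A) n : piece (restr w n.+1) (@coding R d Phi w).
Proof.
pose S n := piece (@restr A w n.+1).
have cS k : compact (S k).
  rewrite /S restr_cons; apply: (piece_compact_sub _).1.
  by rewrite -restr_cons; exact: restr_admissible.
have Santi i j : (i <= j)%N -> S j `<=` S i.
  elim: j => [|j IH]; first by rewrite leqn0 => /eqP ->.
  rewrite leq_eqVlt => /predU1P[->//|/IH ji].
  by apply: subset_trans ji; exact: piece_anti.
have S0 k : exists x, S k x.
  have [x Xx] := Xset_neq0 (word_ter Phi (restr w k.+1)).
  by exists (phi_word Phi (restr w k.+1) x); exists x.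
have [x xS] := choice S0.
have xev k : (x @ \oo) (S k) by exists k => // j /= kj; exact: Santi (xS j).
have [z [_ clz]] := cS 0%N (x @ \oo) _ (xev 0%N).
have zS k : S k z.
  have : closed (S k) by apply: compact_closed => //; exact: norm_hausdorff.
  by apply => V zV; exact: clz.
have /(xgetPex 0) : exists y, (\bigcap_(n in [set n | (0 < n)%N])
    (phi_word Phi (restr w n) @` X (word_ter Phi (restr w n)))) y.
  by exists z => -[//|k] _; exact: zS.
by move=> /(_ n.+1 (ltn0Sn n)).
Qed.

Lemma coding_shift_Xset (w : EA A) : X (ter (letter w 0)) (@coding R d Phi (sigma w)).
Proof.
rewrite (inc_compat (c := Phi) (set_mem (svalP w) 0%N)).
have := @coding_piece (sigma w) 0; rewrite restr_cons => h.
apply: (piece_compact_sub _).2 h.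
by rewrite -restr_cons; exact: restr_admissible.
Qed.

(** Two sequences with a common prefix of length [n + 2] have tails coded by points of
    the image of the same word, where the Hoelder condition bounds the oscillation of
    [f] by [M * exp (- beta * (n + 2))]. *)
Lemma amalgamated_continuous f : holder_family Phi f ->
  continuous (@amalgamated R d Phi f).
Proof.
move=> [beta b0 [M fM]]; apply: continuous_cylinderP => w e e0.
have [n nM] : exists n : nat, `|M| <= e * (beta * n%:R).
  have Me : 0 <= `|M| / (e * beta) by rewrite divr_ge0// mulr_ge0// ltW.
  exists (Num.bound (`|M| / (e * beta))).
  by have /ltW := archi_boundP Me; rewrite ler_pdivrMr ?mulr_gt0// mulrC mulrA.
exists n.+2 => v /cylinder_restrP vw.
have v0 : letter v 0 = letter w 0 by exact: vw.
have rvw : restr (sigma v) n.+1 = restr (sigma w) n.+1.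
  apply: (@eq_from_nth _ 0%N); rewrite !size_mkseq// => k kn.
  by rewrite !nth_mkseq// !letter_shift vw.
have [x Xx xE] := @coding_piece (sigma w) n.
have [y Xy yE] := @coding_piece (sigma v) n.
rewrite rvw in Xy yE.
have wn : words A n.+2 (restr w n.+2).
  by split; [rewrite size_mkseq|exact: restr_admissible].
have tE : word_ter Phi (restr w n.+2) = word_ter Phi (restr (sigma w) n.+1).
  by rewrite restr_cons /word_ter restr_cons.
have := fM n.+2 _ isT wn x y; rewrite tE => /(_ Xx Xy).
rewrite (restr_cons w n.+1) ![head _ _]/= ![behead _]/= xE yE /amalgamated v0 => h.
have E0 := expR_gt0 (beta * n.+2%:R).
rewrite -(ler_pM2r E0); apply: (le_trans h); apply: (le_trans (ler_norm _)).
apply: (le_trans nM); rewrite ler_pM2l//.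
apply: (@le_trans _ _ (beta * n.+2%:R)); first by rewrite ler_pM2l// ler_nat ltnW// ltnW.
by apply: le_trans (expR_ge1Dx _); rewrite lerDr.
Qed.

End coding.

(** * The Manhattan region and the minimizing limit *)

Section manhattan.
Context {R : realType} {d : nat} (Phi : CGDMS R d).
Notation ter := (ter Phi).
Notation X := (@Xset R d Phi).

Lemma ln_dphi_le_sup e x : X (ter e) x -> log_dphi Phi e x <= ln (dphi_sup Phi e).
Proof.
move=> Xx; have Wx := Xset_subW Xx.
by rewrite ler_ln ?posrE ?dphi_sup_gt0 ?dphi_gt0// dphi_le_sup.
Qed.

Lemma log_dphi_le0 e x : X (ter e) x -> log_dphi Phi e x <= 0.
Proof. by move=> /Xset_subW Wx; apply: ln_le0; exact: dphi_le1. Qed.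

(** For negative [q] the lower bound on [f] bounds the power of the supremum from above.
    If [expR \o f e] is unbounded on [X], its supremum is 0 by convention, and so is the
    term. *)
Lemma manhattan_term_le (f : fun_family) (alpha gamma q t : R) e :
  0 < alpha -> (forall e x, X (ter e) x -> - alpha * log_dphi Phi e x + gamma <= f e x) ->
  0 <= t -> (d + 2)%:R <= - alpha * q -> q < 0 ->
  supnorm (X (ter e)) (expR \o f e) `^ q * dphi_sup Phi e `^ t <=
  expR (q * gamma) * dphi_sup Phi e ^+ (d + 2).
Proof.
move=> a0 fP t0 dq q0.
have s0 := dphi_sup_gt0 Phi e.
have rhs0 : 0 <= expR (q * gamma) * dphi_sup Phi e ^+ (d + 2).
  by rewrite mulr_ge0 ?expR_ge0 ?exprn_ge0// ltW.
rewrite /supnorm; set S := [set _ | _ in _].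
have [hS|nS] := pselect (has_sup S); last first.
  by rewrite sup_out// powR0 ?lt_eqF// mul0r.
have [x Xx] := Xset_neq0 (ter e).
have lnS : gamma - alpha * ln (dphi_sup Phi e) <= ln (sup S).
  have supS : expR (f e x) <= sup S.
    by apply: (sup_upper_bound hS); exists x => //=; rewrite gtr0_norm ?expR_gt0.
  have supS0 : 0 < sup S := lt_le_trans (expR_gt0 _) supS.
  rewrite -ler_expR lnK ?posrE//; apply: le_trans supS; rewrite ler_expR.
  apply: le_trans (fP e x Xx).
  by have := ler_wpM2l (ltW a0) (ln_dphi_le_sup Xx); lra.
have supS0 : 0 < sup S.
  apply: lt_le_trans (expR_gt0 (f e x)) _.
  by apply: (sup_upper_bound hS); exists x => //=; rewrite gtr0_norm ?expR_gt0.
rewrite /powR !gt_eqF// -expRD -[X in _ * X ^+ _]lnK ?posrE// -expRM_natl -expRD ler_expR.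
have ls0 : ln (dphi_sup Phi e) <= 0 by apply: ln_le0; exact: dphi_sup_le1.
have h1 : q * ln (sup S) <= q * (gamma - alpha * ln (dphi_sup Phi e)) by rewrite ler_nM2l.
have h2 : t * ln (dphi_sup Phi e) <= 0 by rewrite mulr_ge0_le0.
have h3 : (- alpha * q) * ln (dphi_sup Phi e) <= (d + 2)%:R * ln (dphi_sup Phi e).
  by rewrite ler_wnM2r.
by lra.
Qed.

Lemma manhattan_near (f : fun_family) (alpha gamma t : R) (q : nat -> R) :
  0 < alpha -> (forall e x, X (ter e) x -> - alpha * log_dphi Phi e x + gamma <= f e x) ->
  0 <= t -> q n @[n --> \oo] --> -oo ->
  \forall n \near \oo, manhattan Phi f (t, q n).
Proof.
move=> a0 fP t0 qNy; have [Z Z0 sumZ] := dphi_summable Phi.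
near=> n.
have qn : q n <= - ((d + 2)%:R / alpha) by near: n; exact: (cvgrNy_le qNy).
have q0 : q n < 0.
  by apply: le_lt_trans qn _; rewrite oppr_lt0 divr_gt0// ltr0n addn2.
have dq : (d + 2)%:R <= - alpha * q n.
  by rewrite mulNr -mulrN mulrC -ler_pdivrMr// lerNr.
rewrite /manhattan /=.
apply: (@le_lt_trans _ _ (expR (q n * gamma) * Z)%:E); last exact: ltry.
apply: lime_le.
  apply: is_cvg_nneseries => e _ _; rewrite lee_fin mulr_ge0 ?powR_ge0//.
apply: nearW => m; rewrite big_mkord sumEFin lee_fin.
apply: (le_trans (ler_sum _ (fun (e : 'I_m) _ => manhattan_term_le e a0 fP t0 dq q0))).
by rewrite -mulr_sumr; apply: ler_wpM2l; [exact: expR_ge0|exact: sumZ].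
Unshelve. all: by end_near. Qed.

End manhattan.

Theorem proposition1p1p3 (R : realType) (d : nat) (Phi : CGDMS R d)
    (f : fun_family) (t : R) (q : nat -> R)
    (mu : nat -> probability (EAborel (inc Phi)) R) :
  finitely_irreducible (inc Phi) ->
  holder_family Phi f ->
  comparable_to_log_dphi Phi f ->
  0 <= t -> (t%:E <= bowen Phi)%E ->
  (forall n, q n.+1 < q n) ->
  q n @[n --> \oo] --> -oo ->
  (forall n, manhattan Phi f (t, q n) ->
    shift_invariant (mu n) /\ gibbs_state (@potential R d Phi f t (q n)) (mu n)) ->
  exists mu_infty : probability (EAborel (inc Phi)) R,
    cluster ((mu n : weakstar (inc Phi))
               @[n --> within [set n | manhattan Phi f (t, q n)] \oo])
            (mu_infty : weakstar (inc Phi)) /\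
    integral_amalgamated f mu_infty = xi_min Phi f.
Proof.
move=> _ hf [alpha [b [gamma [a0 fP]]]] t0 _ _ qNy muP.
have fP1 e x : Xset (ter Phi e) x -> - alpha * log_dphi Phi e x + gamma <= f e x.
  by move=> /fP /andP[].
pose D := [set n | manhattan Phi f (t, q n)].
have Dnear : \forall n \near \oo, D n by exact: (manhattan_near a0 fP1 t0 qNy).
have [Z Z0 sumZ] := dphi_summable Phi.
pose p e := dphi_sup Phi e ^+ (d + 2) / Z.
have p0 e : 0 < p e by rewrite divr_gt0// exprn_gt0// dphi_sup_gt0.
have p1 N : \sum_(e < N) p e <= 1.
  by rewrite -mulr_suml ler_pdivrMr// mul1r; exact: sumZ.
(* The additive constant only shifts the pressures and all the integrals. *)
pose F (w : EA (inc Phi)) := amalgamated f w - gamma.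
pose Xi (w : EA (inc Phi)) := amalgamated (log_dphi Phi) w.
have cF : continuous F.
  move=> w; apply: (@continuous_comp _ _ _ (@amalgamated R d Phi f) (fun x => x - gamma)).
    exact: amalgamated_continuous.
  by apply: cvgB; [exact: cvg_id|exact: cvg_cst].
have Xi0 w : Xi w <= 0 by apply: log_dphi_le0; exact: coding_shift_Xset.
have FXi w : - alpha * Xi w <= F w.
  by rewrite /F lerBrDr; apply: fP1; exact: coding_shift_Xset.
have F0 w : 0 <= F w.
  by apply: le_trans (FXi w); rewrite mulNr oppr_ge0 mulr_ge0_le0// ltW.
pose k := (d + 2)%:R / alpha.
have k0 : 0 <= k by rewrite divr_ge0// ltW.
have XF0 w : - Xi w <= alpha^-1 * F w.
  by rewrite -ler_pdivrMl ?invr_gt0// invrK mulrN -mulNr.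
have lnpF w : - ln (p (letter w 0)) <= k * F w + `|ln Z|.
  rewrite /p lnM ?posrE ?invr_gt0 ?exprn_gt0 ?dphi_sup_gt0// lnV ?posrE//.
  rewrite lnXn ?dphi_sup_gt0//.
  have := ln_dphi_le_sup (@coding_shift_Xset R d Phi w); rewrite -/(Xi w) => h.
  have h1 : - ln (dphi_sup Phi (letter w 0)) <= alpha^-1 * F w.
    by apply: le_trans (XF0 w); rewrite lerN2.
  have := ler_wpM2l (ler0n R (d + 2)) h1; rewrite mulrA -/k -mulr_natl.
  by have := ler_norm (ln Z); lra.
have XF w : - Xi w <= k * F w + `|ln Z|.
  apply: (le_trans (XF0 w)); apply: ler_wpDr => //; rewrite ler_wpM2r//.
  by rewrite /k ler_peMl ?invr_ge0 ?(ltW a0)// ler1n addn2.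
have muinv n : D n -> shift_invariant (mu n) by move=> /muP[].
have mugibbs n : D n -> gibbs_state (fun w => t * Xi w + q n * F w) (mu n).
  move=> /muP[_ [P [C [C1 PC]]]]; exists (P - q n * gamma), C; split => // u ua rho urho.
  pose V := @potential R d Phi f t (q n).
  pose x j := iter j (@Defs.shift (inc Phi)) rho.
  rewrite (_ : _ - _ = \sum_(j < size u) V (x j) - P * (size u)%:R); first exact: PC.
  transitivity (\sum_(j < size u) (V (x j) - q n * gamma)
      - (P - q n * gamma) * (size u)%:R).
    by congr (_ - _); apply: eq_bigr => j _; rewrite /V /potential /F /Xi; ring.
  by rewrite sumrB sumr_const card_ord -mulr_natr; ring.
have [nu [clnu nuinv numin]] :=
  zero_temperature_limit cF F0 p0 p1 k0 (normr_ge0 _) t0 lnpF Xi0 XF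
    qNy Dnear muinv mugibbs.
exists nu; split => //.
have intE (m : probability (EAborel (inc Phi)) R) :
    integral_amalgamated f m = (\int[m]_w (F w)%:E + gamma%:E)%E.
  rewrite -integral_add_const//; last exact: measurable_continuousEA.
  by apply: eq_integral => w _; rewrite subrK.
apply/eqP; rewrite eq_le; apply/andP; split.
  apply: le_ereal_inf_tmp => _ [nu' inv' <-]; rewrite !intE leeD2r//.
  exact: numin.
by apply: ge_ereal_inf; exists (integral_amalgamated f nu) => //; exists nu.
Qed.
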